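(* Consider the holomorphic map $F:\mathbf{C}^2\to\mathbf{C}^3$, $(u,v)\mapsto(x,y,z)=\left(u(u-1),\,v,\,u^2(u-1)\right)$. For any $c$, $F$ restricted to the line $\{v=c\}$ is an embedding outside the two points $(0,c)$ and $(1,c)$, and $F$ sends $(0,t)$ and $(1,t)$ to $(0,t,0)$ for all $t$. Let $S$ be the boundary of the ball $B=\{(u,v)\in\mathbf{C}^2:\|(u,v)\|\le 2\}$. Then the mapping $F$ restricted to $S$ is still an embedding, and the image $F(S)$ is a strongly pseudoconvex CR manifold in $\mathbf{C}^3$. The variety that $F(S)$ bounds is $F(B)$, and $F(B)$ has curve singularities along the line $(0,t,0)$. Moreover, $F(\mathbf{C}^2)$ is the hypersurface $\{(x,y,z)\in\mathbf{C}^3: z^2-zx-x^3=0\}$ in $\mathbf{C}^3$.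
   Context: Here $\|\cdot\|$ is the Euclidean norm on $\mathbf{C}^2$. A real submanifold $M\subset\mathbf{C}^N$ of real dimension $2n-1$ is a CR manifold (of hypersurface type) if its holomorphic tangent spaces $T_pM\cap iT_pM$ have constant complex dimension $n-1$; it is strongly pseudoconvex if its Levi form is definite at every point. ''The variety that $F(S)$ bounds'' refers to the complex analytic variety (here of dimension $2$) having $F(S)$ as its boundary. ''Curve singularities'' means that the singularities are not isolated but occur along a complex curve. *)

(* Defs.v *)
From HB Require Import structures.
From mathcomp Require Import all_boot all_order all_algebra complex.
From mathcomp Require Import all_classical all_reals all_analysis.

Set Implicit Arguments.
Unset Strict Implicit.
Unset Printing Implicit Defensive.
Import Order.TTheory GRing.Theory Num.Theory.
Import numFieldNormedType.Exports.
Local Open Scope classical_set_scope.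
Local Open Scope ring_scope.

(** * Complex n-space *)

(* [C^n] is carried by the real normed space [R^n * R^n], the point [(a, b)]
   standing for [a + i b]; this makes the real differential calculus of the
   library available on it.  Its topology is the usual one. *)
Notation Cn R n := ('rV[R]_n * 'rV[R]_n)%type.

Section ComplexSpace.
Variables (R : realType) (n : nat).

Definition ccoord (p : Cn R n) (j : 'I_n) : R[i] := Complex (p.1 0 j) (p.2 0 j).

Definition cvec (s : seq R[i]) : Cn R n :=
  (\row_j complex.Re s`_j, \row_j complex.Im s`_j).

Definition mulI (v : Cn R n) : Cn R n := (- v.2, v.1).

Definition cscale (c : R[i]) (v : Cn R n) : Cn R n :=
  complex.Re c *: v + complex.Im c *: mulI v.

Definition ccomb (k : nat) (e : 'I_k -> Cn R n) (c : 'rV[R[i]]_k) : Cn R n :=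
  \sum_i cscale (c 0 i) (e i).

Definition has_cdim (k : nat) (V : set (Cn R n)) : Prop :=
  exists2 e : 'I_k -> Cn R n, injective (ccomb e) & V = range (ccomb e).

Definition enorm (p : Cn R n) : R :=
  Num.sqrt (\sum_j (p.1 0 j ^+ 2 + p.2 0 j ^+ 2)).

End ComplexSpace.

(** * Smooth and holomorphic maps, embeddings *)

Section Maps.
Variable R : realType.

(* The set [O] is always meant to be open. *)
Fixpoint Ck_on (E G : normedModType R) (k : nat) (O : set E) (f : E -> G) :
    Prop :=
  if k is k'.+1 then
    (forall x, O x -> differentiable f x) /\
    (forall v : E, Ck_on k' O ('D_v f))
  else forall x, O x -> {for x, continuous f}.

Definition smooth_on (E G : normedModType R) (O : set E) (f : E -> G) : Prop :=
  forall k, Ck_on k O f.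

(* Complex differentiability: the real differential is C-linear. *)
Definition holomorphic_on (m n : nat) (O : set (Cn R m))
    (f : Cn R m -> Cn R n) : Prop :=
  forall p, O p ->
    differentiable f p /\ (forall v, 'd f p (mulI v) = mulI ('d f p v)).

Definition topological_embedding (T U : topologicalType) (A : set T)
    (f : T -> U) : Prop :=
  {within A, continuous f} /\
  exists2 g : U -> T, {within f @` A, continuous g} &
    forall x, A x -> g (f x) = x.

End Maps.

(** * Real submanifolds and their tangent spaces *)

Section Submanifolds.
Variables (R : realType) (N : nat).
Implicit Types (M : set (Cn R N)) (p : Cn R N).

(* A smooth embedded submanifold of real dimension [d]: locally the
   homeomorphic image of a smooth immersion of an open subset of [R^d]. *)
Definition submanifold (d : nat) M : Prop :=
  forall p, M p -> exists (O : set (Cn R N)) (W : set 'rV[R]_d)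
                          (phi : 'rV[R]_d -> Cn R N),
    [/\ open O /\ O p, open W /\ smooth_on W phi,
        forall w, W w -> injective ('d phi w),
        topological_embedding W phi & phi @` W = M `&` O].

(* Velocity vectors at [p] of the smooth curves in [M] through [p]. *)
Definition tangent M p : set (Cn R N) :=
  [set v | exists (O : set R) (gamma : R -> Cn R N),
    [/\ open O /\ O 0, @smooth_on R R^o _ O gamma,
        gamma @` O `<=` M, gamma 0 = p & derive1 gamma 0 = v]].

Definition holomorphic_tangent M p : set (Cn R N) :=
  tangent M p `&` (@mulI R N) @` tangent M p.

(** * CR manifolds of hypersurface type and their Levi form *)

Definition CR_manifold (n : nat) M : Prop :=
  submanifold (2 * n - 1)%N M /\
  forall p, M p -> has_cdim (n - 1)%N (holomorphic_tangent M p).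

(* Smooth sections over [M], near [p], of the bundle of holomorphic tangent
   spaces, given as ambient vector fields. *)
Definition local_section M p (X : Cn R N -> Cn R N) : Prop :=
  exists O : set (Cn R N),
    [/\ open O, O p, smooth_on O X &
        forall q, M q -> O q -> holomorphic_tangent M q (X q)].

Definition lie_bracket (X Y : Cn R N -> Cn R N) p : Cn R N :=
  'D_(X p) Y p - 'D_(Y p) X p.

(* The Levi form of [M] at [p] takes its values in the real line
   [T_p M / H_p M], which a covector [theta] vanishing on the holomorphic
   tangent space [H_p M] identifies with [R].  For real sections [X], [Y]
   of the holomorphic tangent bundle its value is the class of [[X, iY]]; for
   the (1,0)-field [L = X - i JX] one has [[L, conj L] = 2i [X, JX]], so this
   is, up to a nonzero constant, the value on [L] of the Hermitian form
   [(L, L') |-> [L, conj L'] / i], of which it is in general the real part. *)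
Definition levi_form M p (theta : Cn R N -> R) (v w : Cn R N) (c : R) :
    Prop :=
  exists X Y : Cn R N -> Cn R N,
    [/\ local_section M p X, local_section M p Y, X p = v, Y p = w &
        theta (lie_bracket X (@mulI R N \o Y) p) = c].

(* As [theta] may be replaced by [- theta], definiteness is positivity for a
   suitable choice of [theta]. *)
Definition levi_definite M p : Prop :=
  exists theta : {linear Cn R N -> R},
    (forall v, holomorphic_tangent M p v -> theta v = 0) /\
    (forall v, holomorphic_tangent M p v -> v != 0 ->
       (exists c, levi_form M p theta v v c) /\
       (forall c, levi_form M p theta v v c -> 0 < c)).

Definition strongly_pseudoconvex M : Prop :=
  forall p, M p -> levi_definite M p.

(** * Complex analytic varieties *)

Definition analytic_subset (Omega V : set (Cn R N)) : Prop :=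
  V `<=` Omega /\
  forall p, Omega p ->
    exists (O : set (Cn R N)) (k : nat) (f : Cn R N -> Cn R k),
      [/\ open O, O p, holomorphic_on O f &
          V `&` O = [set q | O q /\ f q = 0]].

Definition complex_manifold_at (d : nat) (V : set (Cn R N)) p : Prop :=
  exists (O : set (Cn R N)) (W : set (Cn R d)) (phi : Cn R d -> Cn R N),
    [/\ open O /\ O p, open W /\ holomorphic_on W phi,
        forall w, W w -> injective ('d phi w),
        topological_embedding W phi & phi @` W = V `&` O].

Definition singular_locus (V : set (Cn R N)) : set (Cn R N) :=
  [set p | V p /\ ~ exists d, complex_manifold_at d V p].

Definition pure_variety (d : nat) (Omega V : set (Cn R N)) : Prop :=
  analytic_subset Omega V /\
  V `<=` closure [set p | V p /\ complex_manifold_at d V p].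

(* [V] is a compact [d]-dimensional variety with boundary [M]: it is
   analytic off [M], and [M] consists of the points that have to be added to
   [V `\` M] to obtain its closure. *)
Definition bounds (d : nat) (M V : set (Cn R N)) : Prop :=
  [/\ compact V, M `<=` V, pure_variety d (~` M) (V `\` M) &
      closure (V `\` M) = V].

(* The singularities of [V] fill a nonempty (relatively) open piece of the
   complex curve [C]. *)
Definition curve_singularities (V C : set (Cn R N)) : Prop :=
  [/\ pure_variety 1 setT C, singular_locus V !=set0 &
      exists2 O : set (Cn R N), open O & singular_locus V = C `&` O].

End Submanifolds.

(* [f] need only be injective on [A], and its differential only on the tangent
   spaces of the submanifold [A]. *)
Definition smooth_embedding (R : realType) (m n : nat) (A : set (Cn R m))
    (f : Cn R m -> Cn R n) : Prop :=
  [/\ exists O : set (Cn R m), [/\ open O, A `<=` O & smooth_on O f],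
      forall p v, A p -> tangent A p v -> 'd f p v = 0 -> v = 0 &
      topological_embedding A f].

(** * The example *)

Section Example.
Variable R : realType.

Definition Fmap (p : Cn R 2) : Cn R 3 :=
  let u := ccoord p 0 in let v := ccoord p 1 in
  cvec 3 [:: u * (u - 1); v; u ^+ 2 * (u - 1)].

Definition ballB : set (Cn R 2) := [set p | enorm p <= 2].

Definition sphereS : set (Cn R 2) := closure ballB `\` interior ballB.

End Example.

(* Main.v *)
Require Import Defs.
From HB Require Import structures.
From mathcomp Require Import all_boot all_order all_algebra complex.
From mathcomp Require Import ring lra.
From mathcomp Require Import all_classical all_reals all_analysis.
Import Order.TTheory GRing.Theory Num.Theory.
Import numFieldNormedType.Exports.
Local Open Scope classical_set_scope.
Local Open Scope ring_scope.
Set Implicit Arguments.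
Unset Strict Implicit.
Unset Printing Implicit Defensive.

(** The map [F] is an immersion whose only double points are [(0,t)] and
    [(1,t)]; at most one of the two lies on the sphere of radius 2, so [F]
    embeds the sphere.  Near a point of the sphere, [u] is recovered from the
    image as [z / x] or, where [x = 0], as the root
    [(1 +- sqrt (1 + 4x)) / 2] of [u (u - 1) = x]; these smooth left inverses
    carry tangent spaces and sections between the sphere and its image.  The
    Levi form is computed by differentiating along a curve in the boundary the
    relation saying that a section is orthogonal to the radius: at the vector
    [dF (a, b)] it is [2 (|a|^2 + |b|^2)].

    The image of the ball is locally the hypersurface [z^2 - zx - x^3 = 0] when
    all preimages of the point are interior, and a single sheet otherwise.  Two
    sheets cross along the points [(0,t,0)] with [|t|^2 < 3]: a complex manifold
    there would have a tangent space containing both tangent planes, hence all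
    of [C^3], while it must lie in the cone [z^2 = zx]. *)

(** The obstacle is that charts, tangent curves and sections of the image are ambient data, so a
    smooth left inverse of [F] has to live on an open subset of C^3, although [F] identifies (0, t)
    with (1, t). On the sphere these two points have |v|^2 = 4 and |v|^2 = 3 respectively, so near x
    = 0 the coordinate y = v tells which root of u (u - 1) = x to take. The same numbers govern the
    variety: for |t|^2 < 3 both preimages of (0, t, 0) are interior, for 3 < |t|^2 < 4 only (0, t)
    lies in the ball, and for |t|^2 = 3 the point is on the boundary and is removed. The covector
    for the Levi form comes from a left inverse of the differential that is polynomial in u. Its
    variation along a curve contributes a complex bilinear term, which cancels in the bracket of X
    with iY. At a crossing point the hypothetical chart has arbitrary dimension and its inverse is
    merely continuous, so curves in the variety lift only continuously. That their velocities lie in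
    the range of the differential of the chart is therefore obtained by first order estimates. *)

Local Notation Re := complex.Re.
Local Notation Im := complex.Im.

(** * Smooth functions *)

Section SmoothFunctions.
Variables (R : realType) (E : normedModType R).
Implicit Types (O : set E) (k : nat).

Lemma near_eq_differentiable (G : normedModType R) (f g : E -> G) (x : E) :
  (\forall y \near x, f y = g y) -> differentiable f x -> differentiable g x.
Proof.
move=> fg df.
have fgx := nbhs_singleton fg.
have cdf : continuous ('d f x) by exact: diff_continuous.
have dg : g \o shift x = cst (g x) + 'd f x +o_ 0 id.
  have /eqaddoP dfo := diff_locally df.
  apply/eqaddoP => e e0; have := dfo e e0; apply: filter_app.
  have : \forall h \near (0 : E), f (h + x) = g (h + x).
    by move: fg; rewrite [X in X -> _](near_shift 0) subr0.
  by apply: filterS => h fgh; rewrite !fctE /= /cst fgx fgh.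
by apply/diff_locallyP; rewrite (diff_unique cdf dg).
Qed.

Lemma Ck_onS (G : normedModType R) k O (f : E -> G) :
  Ck_on k.+1 O f -> Ck_on k O f.
Proof.
elim: k f => [|k IH] f [df Df].
  by move=> x /df /differentiable_continuous.
by split => // v; apply: IH.
Qed.

(** The recursion of [Ck_on] runs over the globally defined functions ['D_v f], while formulas for
    derivatives hold only on [O]. Openness lets the equality of functions pass to their derivatives,
    so every closure property below can be proved by rewriting on [O]. *)
Lemma eq_Ck_on (G : normedModType R) k O (f g : E -> G) : open O ->
  (forall x, O x -> f x = g x) -> Ck_on k O f -> Ck_on k O g.
Proof.
move=> oO; have near_fg f' g' x : (forall x, O x -> f' x = g' x) -> O x ->
    \forall y \near x, f' y = g' y :> G.
  by move=> fg Ox; apply: filterS fg _; exact: open_nbhs_nbhs.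
elim: k f g => [|k IH] f g fg.
  move=> cf x Ox; change (g @ x --> g x); rewrite -(fg _ Ox).
  by apply: cvg_trans (cf _ Ox); apply: near_eq_cvg; apply: near_fg.
move=> [df Df]; split=> [x Ox|v].
  exact: near_eq_differentiable (near_fg _ _ _ fg Ox) (df _ Ox).
by apply: IH (Df v) => x Ox; apply: near_eq_derive; exact: near_fg fg Ox.
Qed.

Lemma eq_smooth_on (G : normedModType R) O (f g : E -> G) : open O ->
  (forall x, O x -> f x = g x) -> smooth_on O f -> smooth_on O g.
Proof. by move=> oO fg sf k; exact: eq_Ck_on oO fg (sf k). Qed.

Lemma smooth_on_subset (G : normedModType R) (A O : set E) (f : E -> G) :
  A `<=` O -> smooth_on O f -> smooth_on A f.
Proof.
move=> AO sf k; have := sf k; elim: k f {sf} => [|k IH] f /=.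
  by move=> cf x /AO; apply: cf.
by move=> [df Df]; split=> [x /AO /df//|v]; exact: IH.
Qed.

Lemma Ck_on_cst (G : normedModType R) k O (c : G) : Ck_on k O (cst c : E -> G).
Proof.
elim: k c => [|k IH] c; first by move=> x _; exact: cvg_cst.
split=> [x _|v]; first exact: differentiable_cst.
rewrite (_ : 'D_v _ = cst 0) //.
by apply/funext => x; rewrite derive_cst.
Qed.

Lemma Ck_onD (G : normedModType R) k O (f g : E -> G) : open O ->
  Ck_on k O f -> Ck_on k O g -> Ck_on k O (f + g).
Proof.
move=> oO; elim: k f g => [|k IH] f g.
  by move=> cf cg x Ox; apply: cvgD; [exact: cf|exact: cg].
move=> [df Df] [dg Dg]; split=> [x Ox|v].
  by apply: differentiableD; [exact: df|exact: dg].
apply: (eq_Ck_on oO _ (IH _ _ (Df v) (Dg v))) => x Ox.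
by rewrite deriveD //; apply: diff_derivable; [exact: df|exact: dg].
Qed.

Lemma Ck_onM k O (f g : E -> R) : open O ->
  Ck_on k O f -> Ck_on k O g -> Ck_on k O (f * g).
Proof.
move=> oO; elim: k f g => [|k IH] f g.
  by move=> cf cg x Ox; apply: cvgM; [exact: cf|exact: cg].
move=> sf sg; have [[df Df] [dg Dg]] := (sf, sg); split=> [x Ox|v].
  by apply: differentiableM; [exact: df|exact: dg].
apply: (eq_Ck_on oO _ (Ck_onD oO (IH _ _ (Ck_onS sf) (Dg v))
  (IH _ _ (Ck_onS sg) (Df v)))) => x Ox.
by rewrite deriveM //; apply: diff_derivable; [exact: df|exact: dg].
Qed.

Lemma Ck_onZl (G : normedModType R) k O (f : E -> R) (c : G) : open O ->
  Ck_on k O f -> Ck_on k O (fun x => f x *: c).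
Proof.
move=> oO; elim: k f => [|k IH] f.
  by move=> cf x Ox; apply: cvgZr_tmp; exact: cf.
move=> [df Df]; split=> [x Ox|v].
  exact: (@differentiableZl _ _ G f c x (df x Ox)).
apply: (eq_Ck_on oO _ (IH _ (Df v))) => x Ox.
rewrite [RHS]deriveE; last exact: (@differentiableZl _ _ G f c x (df x Ox)).
by rewrite (@diffZl _ _ G f c x (df x Ox)) (deriveE _ (df x Ox)).
Qed.

Lemma Ck_onV k O (f : E -> R) : open O -> (forall x, O x -> f x != 0) ->
  Ck_on k O f -> Ck_on k O (fun x => (f x)^-1).
Proof.
move=> oO f0; elim: k f f0 => [|k IH] f f0.
  by move=> cf x Ox; apply: cvgV; [exact: f0|exact: cf].
move=> sf; have [df Df] := sf; split=> [x Ox|v].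
  by apply: differentiableV; [exact: df|exact: f0].
have iV := IH _ f0 (Ck_onS sf).
have sN : Ck_on k O (fun _ : E => -1 : R) by exact: Ck_on_cst.
have sD := Ck_onM oO (Ck_onM oO sN (Ck_onM oO iV iV)) (Df v).
apply: (eq_Ck_on oO _ sD) => x Ox.
rewrite deriveV ?f0//; last by apply: diff_derivable; exact: df.
by rewrite !fctE /cst mulN1r expr2 invfM.
Qed.

Lemma differentiable_sqrt (f : E -> R) x : 0 < f x ->
  differentiable f x -> differentiable (fun y => Num.sqrt (f y)) x.
Proof.
move=> f0 df; apply: (@differentiable_comp _ _ _ _ f Num.sqrt) => //.
by apply/derivable1_diffP; have [] := is_derive1_sqrt f0.
Qed.

Lemma derive_sqrt_comp (f : E -> R) x v : 0 < f x -> differentiable f x ->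
  'D_v (fun y => Num.sqrt (f y)) x = (2 * Num.sqrt (f x))^-1 * 'D_v f x.
Proof.
move=> f0 df; have ds : differentiable (Num.sqrt : R -> R) (f x).
  by apply/derivable1_diffP; have [] := is_derive1_sqrt f0.
rewrite [LHS]deriveE; last exact: differentiable_sqrt.
rewrite (@diff_comp _ _ _ _ f Num.sqrt) //= (deriveE _ df).
have [dr _] := is_derive1_sqrt f0.
by rewrite (deriv1E dr) derive1E derive_sqrt // [RHS]mulrC.
Qed.

Lemma Ck_on_sqrt k O (f : E -> R) : open O -> (forall x, O x -> 0 < f x) ->
  Ck_on k O f -> Ck_on k O (fun x => Num.sqrt (f x)).
Proof.
move=> oO f0; elim: k f f0 => [|k IH] f f0.
  move=> cf x Ox; apply: (@continuous_comp _ _ _ f Num.sqrt); first exact: cf.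
  exact: sqrt_continuous.
move=> sf; have [df Df] := sf; split=> [x Ox|v].
  by apply: differentiable_sqrt; [exact: f0|exact: df].
have iV : Ck_on k O (fun x => (Num.sqrt (f x))^-1).
  apply: Ck_onV => // [x Ox|]; last exact: IH (Ck_onS sf).
  by rewrite lt0r_neq0 // sqrtr_gt0 f0.
have sN : Ck_on k O (fun _ : E => 2^-1 : R) by exact: Ck_on_cst.
have sD := Ck_onM oO (Ck_onM oO sN iV) (Df v).
apply: (eq_Ck_on oO _ sD) => x Ox; rewrite derive_sqrt_comp ?f0//; last exact: df.
by rewrite !fctE /cst invfM.
Qed.

Lemma smooth_on_linear (G : normedModType R) O (f : {linear E -> G}) :
  continuous f -> smooth_on O f.
Proof.
move=> cf [|k]; first by move=> x _; exact: cf.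
split=> [x _|v]; first exact: linear_differentiable.
rewrite (_ : 'D_v f = cst (f v)); first exact: Ck_on_cst.
apply/funext => x; rewrite deriveE; last exact: linear_differentiable.
by rewrite diff_lin.
Qed.

End SmoothFunctions.

(** * Complex-valued functions *)

Section ComplexNumbers.
Variable R : realType.
Implicit Types z w : R[i].

Lemma complex_ext z w : Re z = Re w -> Im z = Im w -> z = w.
Proof. by case: z w => [a b] [c d] /= -> ->. Qed.

Lemma ReD z w : Re (z + w) = Re z + Re w. Proof. by case: z w => ? ? []. Qed.
Lemma ImD z w : Im (z + w) = Im z + Im w. Proof. by case: z w => ? ? []. Qed.
Lemma ReN z : Re (- z) = - Re z. Proof. by case: z. Qed.
Lemma ImN z : Im (- z) = - Im z. Proof. by case: z. Qed.
Lemma ReM z w : Re (z * w) = Re z * Re w - Im z * Im w.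
Proof. by case: z w => ? ? []. Qed.
Lemma ImM z w : Im (z * w) = Re z * Im w + Im z * Re w.
Proof. by case: z w => ? ? []. Qed.
Lemma Re0 : Re (0 : R[i]) = 0. Proof. by []. Qed.
Lemma Im0 : Im (0 : R[i]) = 0. Proof. by []. Qed.
Lemma Re1 : Re (1 : R[i]) = 1. Proof. by []. Qed.
Lemma Im1 : Im (1 : R[i]) = 0. Proof. by []. Qed.
Lemma Re_conj z : Re (conjc z) = Re z. Proof. by case: z. Qed.
Lemma Im_conj z : Im (conjc z) = - Im z. Proof. by case: z. Qed.

Lemma Re_nat n : Re (n%:R : R[i]) = n%:R.
Proof. by elim: n => // n IH; rewrite -natr1 ReD IH Re1 natr1. Qed.
Lemma Im_nat n : Im (n%:R : R[i]) = 0.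
Proof. by elim: n => // n IH; rewrite -natr1 ImD IH Im1 addr0. Qed.

Definition ReE := (ReD, ReN, ReM, Re0, Re1, Re_conj, Re_nat).
Definition ImE := (ImD, ImN, ImM, Im0, Im1, Im_conj, Im_nat).
Definition ReImE := (ReE, ImE).

Definition sqn z : R := Re z ^+ 2 + Im z ^+ 2.

Lemma sqn_ge0 z : 0 <= sqn z.
Proof. by rewrite addr_ge0 // sqr_ge0. Qed.

Lemma sqn_eq0 z : (sqn z == 0) = (z == 0).
Proof. by rewrite paddr_eq0 ?sqr_ge0 // !sqrf_eq0 eq_complex. Qed.

Lemma sqn_gt0 z : (0 < sqn z) = (z != 0).
Proof. by rewrite lt0r sqn_eq0 sqn_ge0 andbT. Qed.

Lemma sqnM z w : sqn (z * w) = sqn z * sqn w.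
Proof. by rewrite /sqn ReM ImM; ring. Qed.

Lemma sqn_conj z : sqn (conjc z) = sqn z.
Proof. by rewrite /sqn Re_conj Im_conj sqrrN. Qed.

Lemma sqnN z : sqn (- z) = sqn z.
Proof. by rewrite /sqn ReN ImN !sqrrN. Qed.

Lemma Re_sqrtc z : Re (sqrtc z) = Num.sqrt ((Num.sqrt (sqn z) + Re z) / 2).
Proof. by case: z. Qed.

Lemma Re_sqrtc_gt0 z : 0 < Re z -> 0 < Re (sqrtc z).
Proof.
move=> z0; rewrite Re_sqrtc sqrtr_gt0 divr_gt0 // ltr_pwDr // sqrtr_ge0.
Qed.

(** [sqrtc] is the principal branch: by [Re_sqrtc] its real part is nonnegative, which excludes the
    other root [- z]. *)
Lemma sqrtcK z : 0 < Re z -> sqrtc (z ^+ 2) = z.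
Proof.
move=> z0; have /eqP := sqr_sqrtc (z ^+ 2); rewrite eqf_sqr => /orP[/eqP//|/eqP].
move=> /(congr1 (@complex.Re R)); rewrite ReN Re_sqrtc => sE.
by have := sqrtr_ge0 ((Num.sqrt (sqn (z ^+ 2)) + Re (z ^+ 2)) / 2);
  rewrite sE oppr_ge0 leNgt z0.
Qed.

End ComplexNumbers.

Section ComplexValued.
Variables (R : realType) (E : normedModType R).
Implicit Types (O : set E) (f g : E -> R[i]) (x v : E).

Definition csmooth O f :=
  smooth_on O (fun x => Re (f x)) /\ smooth_on O (fun x => Im (f x)).

Definition cdifferentiable f x :=
  differentiable (fun x => Re (f x)) x /\ differentiable (fun x => Im (f x)) x.

(** The real directional derivative packed as one complex number, so that product rules can be
    finished by [ring] in [R[i]]. *)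
Definition cD v f x : R[i] :=
  Complex ('D_v (fun x => Re (f x)) x) ('D_v (fun x => Im (f x)) x).

Lemma eq_csmooth O f g : open O -> (forall x, O x -> f x = g x) ->
  csmooth O f -> csmooth O g.
Proof.
move=> oO fg [sr si]; split; [apply: eq_smooth_on oO _ sr|
  apply: eq_smooth_on oO _ si]; by move=> x Ox; rewrite fg.
Qed.

Lemma csmooth_subset A O f : A `<=` O -> csmooth O f -> csmooth A f.
Proof. by move=> AO [sr si]; split; exact: smooth_on_subset AO _. Qed.

Lemma csmooth_differentiable O f x : csmooth O f -> O x -> cdifferentiable f x.
Proof. by move=> [/(_ 1)[sr _] /(_ 1)[si _]] Ox; split; [exact: sr|exact: si]. Qed.

Lemma csmooth_real O (f : E -> R) : open O -> smooth_on O f ->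
  csmooth O (fun x => (f x)%:C%C).
Proof. by move=> oO sf; split=> //= k; exact: Ck_on_cst. Qed.

Lemma csmooth_cst O (c : R[i]) : csmooth O (fun _ => c).
Proof. by split=> k; exact: Ck_on_cst. Qed.

Lemma csmoothD O f g : open O -> csmooth O f -> csmooth O g ->
  csmooth O (fun x => f x + g x).
Proof.
move=> oO [fr fi] [gr gi]; split=> k.
  by apply: (eq_Ck_on oO _ (Ck_onD oO (fr k) (gr k))) => x _; rewrite ReD.
by apply: (eq_Ck_on oO _ (Ck_onD oO (fi k) (gi k))) => x _; rewrite ImD.
Qed.

Lemma csmoothM O f g : open O -> csmooth O f -> csmooth O g ->
  csmooth O (fun x => f x * g x).
Proof.
move=> oO [fr fi] [gr gi].
have sN k : Ck_on k O (fun _ : E => -1 : R) by exact: Ck_on_cst.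
split=> k.
  apply: (eq_Ck_on oO _ (Ck_onD oO (Ck_onM oO (fr k) (gr k))
    (Ck_onM oO (sN k) (Ck_onM oO (fi k) (gi k))))) => x _.
  by rewrite ReM !fctE mulN1r.
apply: (eq_Ck_on oO _ (Ck_onD oO (Ck_onM oO (fr k) (gi k))
    (Ck_onM oO (fi k) (gr k)))) => x _.
by rewrite ImM.
Qed.

Lemma csmoothN O f : open O -> csmooth O f -> csmooth O (fun x => - f x).
Proof.
move=> oO sf; apply: (eq_csmooth oO _ (csmoothM oO (csmooth_cst O (-1)) sf)).
by move=> x _; rewrite mulN1r.
Qed.

Lemma csmoothB O f g : open O -> csmooth O f -> csmooth O g ->
  csmooth O (fun x => f x - g x).
Proof. by move=> oO sf sg; apply: csmoothD => //; exact: csmoothN. Qed.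

Lemma csmoothX O f n : open O -> csmooth O f -> csmooth O (fun x => f x ^+ n).
Proof.
move=> oO sf; elim: n => [|n IH].
  by apply: (eq_csmooth oO _ (csmooth_cst O 1)) => x _; rewrite expr0.
by apply: (eq_csmooth oO _ (csmoothM oO sf IH)) => x _; rewrite exprS.
Qed.

Lemma csmooth_conj O f : open O -> csmooth O f ->
  csmooth O (fun x => conjc (f x)).
Proof.
move=> oO [fr fi]; split=> k.
  by apply: (eq_Ck_on oO _ (fr k)) => x _; rewrite Re_conj.
have sN : Ck_on k O (fun _ : E => -1 : R) by exact: Ck_on_cst.
by apply: (eq_Ck_on oO _ (Ck_onM oO sN (fi k))) => x _; rewrite Im_conj !fctE mulN1r.
Qed.

Lemma smooth_sqn O f : open O -> csmooth O f ->
  smooth_on O (fun x => sqn (f x)).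
Proof.
by move=> oO [fr fi] k; exact: (Ck_onD oO (Ck_onM oO (fr k) (fr k))
  (Ck_onM oO (fi k) (fi k))).
Qed.

Lemma smoothV O (f : E -> R) : open O -> (forall x, O x -> f x != 0) ->
  smooth_on O f -> smooth_on O (fun x => (f x)^-1).
Proof. by move=> oO f0 sf k; exact: Ck_onV (sf k). Qed.

(** Since 1/f = conj f / |f|^2, the real inverse suffices. *)
Lemma csmoothV O f : open O -> (forall x, O x -> f x != 0) -> csmooth O f ->
  csmooth O (fun x => (f x)^-1).
Proof.
move=> oO f0 sf.
have s2 : smooth_on O (fun x => (sqn (f x))^-1).
  by apply: smoothV (smooth_sqn oO sf) => // x Ox; rewrite sqn_eq0 f0.
apply: (eq_csmooth oO _ (csmoothM oO (csmooth_conj oO sf)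
  (csmooth_real oO s2))) => x /f0 fx0.
apply: (mulfI fx0); rewrite mulfV // mulrA.
have := fx0; rewrite -sqn_eq0 /sqn => n0.
by apply: complex_ext; rewrite ?ReImE /=; field.
Qed.

(** With [Re f > 0], the nested real roots giving the real part have positive arguments. The
    imaginary part is recovered by division by the real part, which sidesteps the sign of [Im f] in
    the explicit formula. *)
Lemma csmooth_sqrt O f : open O -> (forall x, O x -> 0 < Re (f x)) ->
  csmooth O f -> csmooth O (fun x => sqrtc (f x)).
Proof.
move=> oO f0 sf.
have fN0 x : O x -> 0 < sqn (f x).
  by move=> /f0 fx0; rewrite ltr_pwDl ?sqr_ge0 // exprn_gt0.
have sr : smooth_on O (fun x => Re (sqrtc (f x))).
  have s1 : smooth_on O (fun x => Num.sqrt (sqn (f x))).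
    by move=> k; apply: Ck_on_sqrt => //; exact: smooth_sqn.
  have s2 : smooth_on O (fun x => (Num.sqrt (sqn (f x)) + Re (f x)) * 2^-1).
    move=> k; have sN : Ck_on k O (fun _ : E => 2^-1 : R) by exact: Ck_on_cst.
    by have [sRe _] := sf; exact: (Ck_onM oO (Ck_onD oO (s1 k) (sRe k)) sN).
  have s3 : smooth_on O
      (fun x => Num.sqrt ((Num.sqrt (sqn (f x)) + Re (f x)) * 2^-1)).
    move=> k; apply: Ck_on_sqrt => // x Ox.
    by rewrite divr_gt0 // addr_gt0 ?f0 // sqrtr_gt0 fN0.
  by apply: (eq_smooth_on oO _ s3) => x _; rewrite -Re_sqrtc.
split=> //.
have sV : smooth_on O (fun x => (Re (sqrtc (f x)))^-1).
  by apply: smoothV => // x Ox; rewrite gt_eqF // Re_sqrtc_gt0 // f0.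
have s4 : smooth_on O (fun x => (Im (f x) * 2^-1) * (Re (sqrtc (f x)))^-1).
  move=> k; have sN : Ck_on k O (fun _ : E => 2^-1 : R) by exact: Ck_on_cst.
  by have [_ sIm] := sf; exact: (Ck_onM oO (Ck_onM oO (sIm k) sN) (sV k)).
apply: (eq_smooth_on oO _ s4) => x Ox.
(* twice the product of the real and imaginary parts of the root is [Im] *)
have r0 : Re (sqrtc (f x)) != 0 by rewrite gt_eqF // Re_sqrtc_gt0 // f0.
rewrite -{1}(sqr_sqrtc (f x)) expr2 ImM.
by field.
Qed.

Lemma cD_cst (c : R[i]) v x : cD v (fun _ => c) x = 0.
Proof. by rewrite /cD !derive_cst. Qed.

Lemma near_eq_cD f g v x : (\forall y \near x, f y = g y) -> cD v f x = cD v g x.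
Proof.
by move=> fg; congr Complex; apply: near_eq_derive; apply: filterS fg => y ->.
Qed.

Lemma cDD f g v x : cdifferentiable f x -> cdifferentiable g x ->
  cD v (fun x => f x + g x) x = cD v f x + cD v g x.
Proof.
move=> [fr fi] [gr gi]; apply: complex_ext; rewrite ?ReD ?ImD /=.
  by under eq_fun do rewrite ReD; rewrite deriveD //; exact: diff_derivable.
by under eq_fun do rewrite ImD; rewrite deriveD //; exact: diff_derivable.
Qed.

Lemma cDM f g v x : cdifferentiable f x -> cdifferentiable g x ->
  cD v (fun x => f x * g x) x = cD v f x * g x + f x * cD v g x.
Proof.
move=> [fr fi] [gr gi].
have [frv fiv grv giv] : [/\ derivable (fun x => Re (f x)) x v,
    derivable (fun x => Im (f x)) x v, derivable (fun x => Re (g x)) x v &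
    derivable (fun x => Im (g x)) x v].
  by split; exact: diff_derivable.
have drM (h k : E -> R) : derivable h x v -> derivable k x v ->
    'D_v (fun x => h x * k x) x = h x * 'D_v k x + k x * 'D_v h x.
  exact: deriveM.
have dbM (h k : E -> R) : derivable h x v -> derivable k x v ->
    derivable (fun x => h x * k x) x v.
  exact: derivableM.
apply: complex_ext; rewrite ?ReImE /=.
  under eq_fun do rewrite ReM.
  by rewrite deriveB; [rewrite !drM //; ring|exact: dbM..].
under eq_fun do rewrite ImM.
by rewrite deriveD; [rewrite !drM //; ring|exact: dbM..].
Qed.

Lemma cD_conj f v x : cdifferentiable f x ->
  cD v (fun x => conjc (f x)) x = conjc (cD v f x).
Proof.
move=> [fr fi]; apply: complex_ext; rewrite ?ReImE /=.
  by under eq_fun do rewrite Re_conj.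
by under eq_fun do rewrite Im_conj; rewrite deriveN //; exact: diff_derivable.
Qed.

Lemma cdifferentiable_cst (c : R[i]) x : cdifferentiable (fun _ => c) x.
Proof. by split; exact: differentiable_cst. Qed.

Lemma cdifferentiableD f g x : cdifferentiable f x -> cdifferentiable g x ->
  cdifferentiable (fun x => f x + g x) x.
Proof.
move=> [fr fi] [gr gi]; split.
  by under eq_fun do rewrite ReD; exact: differentiableD.
by under eq_fun do rewrite ImD; exact: differentiableD.
Qed.

Lemma cdifferentiableM f g x : cdifferentiable f x -> cdifferentiable g x ->
  cdifferentiable (fun x => f x * g x) x.
Proof.
move=> [fr fi] [gr gi].
have dM (h k : E -> R) : differentiable h x -> differentiable k x ->
    differentiable (fun x => h x * k x) x.
  exact: differentiableM.
split.
  by under eq_fun do rewrite ReM; apply: differentiableB; exact: dM.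
by under eq_fun do rewrite ImM; apply: differentiableD; exact: dM.
Qed.

Lemma cdifferentiable_conj f x : cdifferentiable f x ->
  cdifferentiable (fun x => conjc (f x)) x.
Proof.
move=> [fr fi]; split; first by under eq_fun do rewrite Re_conj.
by under eq_fun do rewrite Im_conj; exact: differentiableN.
Qed.

End ComplexValued.

(** * Coordinates on complex n-space and coordinatewise calculus *)

Section CoordinateMaps.
Variables (R : realType) (n : nat).
Implicit Types (p : Cn R n) (j : 'I_n).

Definition re_coord j p : R := p.1 0 j.
Definition im_coord j p : R := p.2 0 j.

Lemma re_coord_is_linear j : linear (re_coord j).
Proof. by move=> a u v; rewrite /re_coord /= !mxE. Qed.
Lemma im_coord_is_linear j : linear (im_coord j).
Proof. by move=> a u v; rewrite /im_coord /= !mxE. Qed.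

HB.instance Definition _ j :=
  GRing.isLinear.Build R (Cn R n) R _ (re_coord j) (re_coord_is_linear j).
HB.instance Definition _ j :=
  GRing.isLinear.Build R (Cn R n) R _ (im_coord j) (im_coord_is_linear j).

Lemma continuous_re_coord j : continuous (re_coord j).
Proof.
move=> p; apply: (@continuous_comp _ _ _ fst (fun M : 'rV[R]_n => M 0 j)).
  exact: cvg_fst.
exact: coord_continuous.
Qed.

Lemma continuous_im_coord j : continuous (im_coord j).
Proof.
move=> p; apply: (@continuous_comp _ _ _ snd (fun M : 'rV[R]_n => M 0 j)).
  exact: cvg_snd.
exact: coord_continuous.
Qed.

Lemma csmooth_ccoord (O : set (Cn R n)) j :
  csmooth O (fun p => ccoord p j).
Proof.
split; first exact: smooth_on_linear (@continuous_re_coord j).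
exact: smooth_on_linear (@continuous_im_coord j).
Qed.

Lemma ccoordP p q : (forall j, ccoord p j = ccoord q j) -> p = q.
Proof.
case: p q => [a b] [c d] pq; congr pair.
  by apply/rowP => j; have [] := pq j.
by apply/rowP => j; have [] := pq j.
Qed.

Lemma ccoord_cvec (s : seq R[i]) j : ccoord (cvec n s) j = s`_j.
Proof. by rewrite /ccoord !mxE; case: (s`_j). Qed.

Lemma ccoordD p q j : ccoord (p + q) j = ccoord p j + ccoord q j.
Proof. by apply: complex_ext; rewrite ?ReImE /= mxE. Qed.

Lemma ccoordN p j : ccoord (- p) j = - ccoord p j.
Proof. by apply: complex_ext; rewrite ?ReImE /= mxE. Qed.

Lemma ccoord0 j : ccoord (0 : Cn R n) j = 0.
Proof. by apply: complex_ext; rewrite ?ReImE /= mxE. Qed.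

Lemma ccoordZ a p j : ccoord (a *: p) j = a%:C%C * ccoord p j.
Proof. by apply: complex_ext; rewrite ?ReImE /= mxE; ring. Qed.

Lemma ccoord_mulI p j : ccoord (mulI p) j = 'i%C * ccoord p j.
Proof. by apply: complex_ext; rewrite ?ReImE /= ?mxE; ring. Qed.

Lemma ccoord_cscale c p j : ccoord (Defs.cscale c p) j = c * ccoord p j.
Proof.
rewrite /Defs.cscale ccoordD !ccoordZ ccoord_mulI.
by apply: complex_ext; rewrite ?ReImE /=; ring.
Qed.

Lemma derive_re_coord (E : normedModType R) (f : E -> Cn R n) x v j :
  differentiable f x -> 'D_v (fun x => Re (ccoord (f x) j)) x = re_coord j ('D_v f x).
Proof.
move=> df; have dL : differentiable (re_coord j) (f x).
  exact: linear_differentiable (@continuous_re_coord j).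
rewrite [LHS]deriveE; last exact: (@differentiable_comp _ _ _ _ f (re_coord j)).
rewrite (@diff_comp _ _ _ _ f (re_coord j)) //= (deriveE _ df).
by rewrite diff_lin //; exact: continuous_re_coord.
Qed.

Lemma derive_im_coord (E : normedModType R) (f : E -> Cn R n) x v j :
  differentiable f x -> 'D_v (fun x => Im (ccoord (f x) j)) x = im_coord j ('D_v f x).
Proof.
move=> df; have dL : differentiable (im_coord j) (f x).
  exact: linear_differentiable (@continuous_im_coord j).
rewrite [LHS]deriveE; last exact: (@differentiable_comp _ _ _ _ f (im_coord j)).
rewrite (@diff_comp _ _ _ _ f (im_coord j)) //= (deriveE _ df).
by rewrite diff_lin //; exact: continuous_im_coord.
Qed.

Lemma ccoord_derive (E : normedModType R) (f : E -> Cn R n) x v j :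
  differentiable f x -> ccoord ('D_v f x) j = cD v (fun x => ccoord (f x) j) x.
Proof. by move=> df; rewrite /cD derive_re_coord // derive_im_coord. Qed.

Lemma differentiable_ccoord (E : normedModType R) (f : E -> Cn R n) x j :
  differentiable f x -> cdifferentiable (fun x => ccoord (f x) j) x.
Proof.
move=> df; split.
  apply: (@differentiable_comp _ _ _ _ f (re_coord j)) => //.
  exact: linear_differentiable (@continuous_re_coord j).
apply: (@differentiable_comp _ _ _ _ f (im_coord j)) => //.
exact: linear_differentiable (@continuous_im_coord j).
Qed.

Lemma cD_ccoord v p j : cD v (fun p => ccoord p j) p = ccoord v j.
Proof.
have := @ccoord_derive _ idfun p v j.
rewrite /idfun => <-; last exact: ex_diff.
by rewrite derive_id.
Qed.

Lemma cD_comp (E : normedModType R) (f : E -> Cn R n) (g : Cn R n -> R[i]) x v :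
  differentiable f x -> cdifferentiable g (f x) ->
  cD v (fun x => g (f x)) x = cD ('D_v f x) g (f x).
Proof.
move=> df [gr gi]; apply: complex_ext => /=.
  rewrite [RHS]deriveE // [LHS]deriveE; last first.
    exact: (@differentiable_comp _ _ _ _ f (fun y => Re (g y))).
  by rewrite (@diff_comp _ _ _ _ f (fun y => Re (g y))) //= (deriveE _ df).
rewrite [RHS]deriveE // [LHS]deriveE; last first.
  exact: (@differentiable_comp _ _ _ _ f (fun y => Im (g y))).
by rewrite (@diff_comp _ _ _ _ f (fun y => Im (g y))) //= (deriveE _ df).
Qed.

Lemma cdifferentiable_comp (E : normedModType R) (f : E -> Cn R n)
    (g : Cn R n -> R[i]) x :
  differentiable f x -> cdifferentiable g (f x) ->
  cdifferentiable (fun x => g (f x)) x.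
Proof.
move=> df [gr gi]; split.
  exact: (@differentiable_comp _ _ _ _ f (fun y => Re (g y))).
exact: (@differentiable_comp _ _ _ _ f (fun y => Im (g y))).
Qed.

Lemma Cn_basis p : p = \sum_j (re_coord j p *: ((delta_mx 0 j, 0) : Cn R n) +
  im_coord j p *: ((0, delta_mx 0 j) : Cn R n)).
Proof.
have sum_pair (F : 'I_n -> Cn R n) : \sum_j F j = (\sum_j (F j).1, \sum_j (F j).2).
  elim/big_rec3: _ => // j a b c _ ->.
  by case: (F j).
rewrite sum_pair /=; case: p => a b; congr pair.
  rewrite [LHS]row_sum_delta; apply: eq_bigr => j _.
  by rewrite scaler0 addr0.
rewrite [LHS]row_sum_delta; apply: eq_bigr => j _.
by rewrite scaler0 add0r.
Qed.

Lemma Ck_on_vec (E : normedModType R) (f : E -> Cn R n) k (O : set E) : open O ->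
  (forall j, Ck_on k O (fun x => Re (ccoord (f x) j))) ->
  (forall j, Ck_on k O (fun x => Im (ccoord (f x) j))) -> Ck_on k O f.
Proof.
move=> oO fr fi.
have sj j : Ck_on k O (fun x => re_coord j (f x) *: ((delta_mx 0 j, 0) : Cn R n) +
    im_coord j (f x) *: ((0, delta_mx 0 j) : Cn R n)).
  exact: (Ck_onD oO (Ck_onZl _ oO (fr j)) (Ck_onZl _ oO (fi j))).
have -> : f = \sum_j (fun x => re_coord j (f x) *: ((delta_mx 0 j, 0) : Cn R n) +
    im_coord j (f x) *: ((0, delta_mx 0 j) : Cn R n)).
  by apply/funext => x; rewrite [LHS]Cn_basis fct_sumE.
elim/big_ind: _ => //; first exact: (Ck_on_cst k O (0 : Cn R n)).
by move=> g h sg sh; exact: Ck_onD.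
Qed.

Lemma smooth_vec (E : normedModType R) (f : E -> Cn R n) (O : set E) : open O ->
  (forall j, csmooth O (fun x => ccoord (f x) j)) -> smooth_on O f.
Proof.
by move=> oO sf k; apply: Ck_on_vec => // j; have [sr si] := sf j.
Qed.

Lemma smooth_on_differentiable (E G : normedModType R) (f : E -> G) (O : set E) x :
  smooth_on O f -> O x -> differentiable f x.
Proof. by move=> /(_ 1)[df _] Ox; exact: df. Qed.

Lemma differentiable_vec (E : normedModType R) (f : E -> Cn R n) x :
  (forall j, cdifferentiable (fun x => ccoord (f x) j) x) -> differentiable f x.
Proof.
move=> df.
have sj j : differentiable (fun x => re_coord j (f x) *: ((delta_mx 0 j, 0) : Cn R n) +
    im_coord j (f x) *: ((0, delta_mx 0 j) : Cn R n)) x.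
  have [dr di] := df j; apply: differentiableD.
    exact: (@differentiableZl _ _ _ (fun x => Re (ccoord (f x) j))).
  exact: (@differentiableZl _ _ _ (fun x => Im (ccoord (f x) j))).
have -> : f = \sum_j (fun x => re_coord j (f x) *: ((delta_mx 0 j, 0) : Cn R n) +
    im_coord j (f x) *: ((0, delta_mx 0 j) : Cn R n)).
  by apply/funext => y; rewrite [LHS]Cn_basis fct_sumE.
elim/big_ind: _; [exact: (differentiable_cst (0 : Cn R n))| |by move=> j _; exact: sj].
by move=> g h sg sh; exact: differentiableD.
Qed.

End CoordinateMaps.

Lemma holomorphic_vec (R : realType) (m n : nat) (f : Cn R m -> Cn R n) (O : set (Cn R m)) :
  (forall p, O p -> forall j, cdifferentiable (fun p => ccoord (f p) j) p /\
    forall v, cD (mulI v) (fun p => ccoord (f p) j) p =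
      'i%C * cD v (fun p => ccoord (f p) j) p) ->
  holomorphic_on O f.
Proof.
move=> hf p Op; have df : differentiable f p.
  by apply: differentiable_vec => j; have [] := hf p Op j.
split=> // v; apply: ccoordP => j.
have [_ /(_ v) Jv] := hf p Op j.
rewrite -(deriveE (mulI v) df) -(deriveE v df) ccoord_mulI.
rewrite [LHS](ccoord_derive _ _ df) [X in _ * X](ccoord_derive _ _ df).
exact: Jv.
Qed.

(** The condition on [g] concerns all [y] in [A] with image near [f x], not only those near [x]. At
    [f x] itself it yields injectivity on [A]; nearby it prevents far points of [A] from having
    images that accumulate at [f x]. *)
Lemma topological_embedding_local_inverse (R : realType) (E G : normedModType R)
    (A : set E) (f : E -> G) :
  (forall x, A x -> {for x, continuous f}) ->
  (forall x, A x -> exists2 g : G -> E, {for f x, continuous g} &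
     \forall p \near f x, forall y, A y -> f y = p -> g p = y) ->
  topological_embedding A f.
Proof.
move=> cf lg.
have injf x y : A x -> A y -> f x = f y -> x = y.
  move=> Ax Ay fxy; have [g _ /nbhs_singleton gx] := lg x Ax.
  by rewrite -(gx _ Ax erefl) (gx _ Ay (esym fxy)).
split.
  apply/subspace_continuousP => x Ax; apply: cvg_trans (cf x Ax).
  by apply: cvg_app; exact: cvg_within.
(* The global inverse is chosen pointwise, with value 0 off the image. Near [f x] it agrees on the
   image with the local inverse [g], which gives its continuity there. *)
pose g0 p := if pselect (exists y, A y /\ f y = p) is left e
  then projT1 (cid e) else 0.
have g0K x : A x -> g0 (f x) = x.
  move=> Ax; rewrite /g0; case: pselect => [e|]; last by case; exists x.
  by case: cid => y [Ay fyx]; exact: injf.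
exists g0 => //; apply/subspace_continuousP => _ [x Ax <-].
have [g cg gx] := lg x Ax.
have gfx : g (f x) = x by apply: (nbhs_singleton gx).
have gfx0 : g (f x) = g0 (f x) by rewrite g0K.
have cgw : g @ within (f @` A) (nbhs (f x)) --> g (f x).
  by apply: cvg_trans cg; apply: cvg_app; exact: cvg_within.
rewrite gfx0 in cgw; apply: cvg_trans cgw; apply: near_eq_cvg; rewrite near_withinE.
by apply: filterS gx => p gp [y Ay fyp]; rewrite (gp y Ay fyp) -fyp; exact/esym/g0K.
Qed.

(** * Points, spheres and balls *)

Section Points.
Variable R : realType.
Implicit Types (u v x y z : R[i]).

Definition pt2 u v : Cn R 2 := cvec 2 [:: u; v].
Definition pt3 x y z : Cn R 3 := cvec 3 [:: x; y; z].

Lemma pt2_0 u v : ccoord (pt2 u v) 0 = u.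
Proof. by rewrite ccoord_cvec. Qed.
Lemma pt2_1 u v : ccoord (pt2 u v) 1 = v.
Proof. by rewrite ccoord_cvec. Qed.
Lemma pt3_0 x y z : ccoord (pt3 x y z) 0 = x.
Proof. by rewrite ccoord_cvec. Qed.
Lemma pt3_1 x y z : ccoord (pt3 x y z) 1 = y.
Proof. by rewrite ccoord_cvec. Qed.
Lemma pt3_2 x y z : ccoord (pt3 x y z) 2 = z.
Proof. by rewrite ccoord_cvec. Qed.
Definition ptE := (pt2_0, pt2_1, pt3_0, pt3_1, pt3_2).

Lemma ord2P (P : 'I_2 -> Prop) : P 0 -> P 1 -> forall j, P j.
Proof.
move=> P0 P1 [[|[|//]] lt]; first by rewrite (_ : Ordinal lt = 0) //; apply: val_inj.
by rewrite (_ : Ordinal lt = 1) //; apply: val_inj.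
Qed.

Lemma ord3P (P : 'I_3 -> Prop) : P 0 -> P 1 -> P 2 -> forall j, P j.
Proof.
move=> P0 P1 P2 [[|[|[|//]]] lt]; first by rewrite (_ : Ordinal lt = 0) //; apply: val_inj.
  by rewrite (_ : Ordinal lt = 1) //; apply: val_inj.
by rewrite (_ : Ordinal lt = 2) //; apply: val_inj.
Qed.

Lemma pt2P (p : Cn R 2) : p = pt2 (ccoord p 0) (ccoord p 1).
Proof. by apply: ccoordP; apply: ord2P; rewrite ptE. Qed.

Lemma pt3P (p : Cn R 3) : p = pt3 (ccoord p 0) (ccoord p 1) (ccoord p 2).
Proof. by apply: ccoordP; apply: ord3P; rewrite ptE. Qed.

Lemma pt3_inj x y z x' y' z' :
  pt3 x y z = pt3 x' y' z' -> [/\ x = x', y = y' & z = z'].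
Proof.
by move=> e; rewrite -(pt3_0 x y z) -{2}(pt3_1 x y z) -{3}(pt3_2 x y z) e !ptE.
Qed.

Lemma FmapE u v : Fmap (pt2 u v) = pt3 (u * (u - 1)) v (u ^+ 2 * (u - 1)).
Proof. by rewrite /Fmap !ptE. Qed.

Lemma Fmap0 (p : Cn R 2) : ccoord (Fmap p) 0 = ccoord p 0 * (ccoord p 0 - 1).
Proof. by rewrite [p in LHS]pt2P FmapE ptE. Qed.
Lemma Fmap1 (p : Cn R 2) : ccoord (Fmap p) 1 = ccoord p 1.
Proof. by rewrite [p in LHS]pt2P FmapE ptE. Qed.
Lemma Fmap2 (p : Cn R 2) : ccoord (Fmap p) 2 = ccoord p 0 ^+ 2 * (ccoord p 0 - 1).
Proof. by rewrite [p in LHS]pt2P FmapE ptE. Qed.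

Definition sqnorm (p : Cn R 2) : R := sqn (ccoord p 0) + sqn (ccoord p 1).

Lemma sqnorm_pt2 u v : sqnorm (pt2 u v) = sqn u + sqn v.
Proof. by rewrite /sqnorm !ptE. Qed.

Lemma ballBE : @ballB R = [set p | sqnorm p <= 4].
Proof.
have s4 : Num.sqrt 4 = 2 :> R.
  by rewrite (_ : 4 = 2 ^+ 2) ?sqrtr_sqr ?ger0_norm //; ring.
apply/seteqP; split=> p; rewrite /ballB /enorm /= big_ord_recl big_ord1;
  rewrite (_ : lift _ _ = 1) -/(sqnorm p) ?lift0 //; try exact: val_inj;
  by rewrite -{1}s4 ler_sqrt.
Qed.

Lemma sqnormZ (a : R) (p : Cn R 2) : sqnorm (a *: p) = a ^+ 2 * sqnorm p.
Proof. by rewrite /sqnorm /sqn !ccoordZ !ReImE /=; ring. Qed.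

Lemma smooth_sqnorm (O : set (Cn R 2)) : open O -> smooth_on O sqnorm.
Proof.
move=> oO k; have s j := smooth_sqn oO (csmooth_ccoord O j).
exact: (Ck_onD oO (s _ k) (s _ k)).
Qed.

Lemma continuous_sqnorm : continuous sqnorm.
Proof. by move=> p; exact: (smooth_sqnorm openT 0%N). Qed.

End Points.

Section OpenSets.
Variables (R : realType) (T : topologicalType).

Lemma open_lt_fun (O : set T) (f g : T -> R) : open O ->
  (forall x, O x -> {for x, continuous f}) ->
  (forall x, O x -> {for x, continuous g}) ->
  open [set x | O x /\ f x < g x].
Proof.
move=> oO cf cg; rewrite openE => x [Ox fgx].
have nO : \forall y \near x, O y by exact: open_nbhs_nbhs.
have nlt : \forall y \near x, 0 < g y - f y.
  have cgf : (fun y => g y - f y) @ x --> g x - f x.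
    by apply: cvgB; [exact: cg|exact: cf].
  apply: (cgf [set r | 0 < r]); apply: open_nbhs_nbhs.
  by split; [exact: open_gt|rewrite /= subr_gt0].
by apply: filterS2 nO nlt => y Oy; rewrite subr_gt0.
Qed.

Lemma closed_le_fun (f : T -> R) (a : R) : continuous f -> closed [set x | f x <= a].
Proof.
move=> cf; rewrite -[mkset _]/(f @^-1` [set r | r <= a]).
by apply: preimage_closed; [move=> x _; exact: cf|exact: closed_le].
Qed.

End OpenSets.

Section Ball.
Variable R : realType.
Implicit Types p : Cn R 2.

Lemma closed_ballB : closed (@ballB R).
Proof.
by rewrite ballBE; apply: closed_le_fun; exact: continuous_sqnorm.
Qed.

Lemma sphereSE : @sphereS R = [set p | sqnorm p = 4].
Proof.
rewrite /sphereS -((closure_id (@ballB R)).1 closed_ballB).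
rewrite ballBE; apply/seteqP; split=> p /=.
  move=> [ple]; apply: contra_notP => pn4.
  have plt : sqnorm p < 4 by rewrite lt_neqAle ple andbT; exact/eqP.
  have oU := open_lt_fun openT (f := @sqnorm R) (g := fun _ : Cn R 2 => 4)
    (fun p _ => @continuous_sqnorm R p) (fun p _ => cvg_cst _).
  have nlt : nbhs p [set q | setT q /\ sqnorm q < 4].
    by apply: open_nbhs_nbhs; split; [exact: oU|split].
  by apply: (filterS _ nlt) => q [_ /ltW].
move=> p4; split; first by rewrite p4.
(* An interior point could be pushed outwards along its radius, but [(1 + t) *: p] has squared norm
   4 (1 + t)^2 > 4 for t > 0. *)
move=> pint; have : \forall t \near (0 : R), sqnorm ((1 + t) *: p) <= 4.
  have ct : (fun t : R => (1 + t) *: p) @ (0 : R) --> (1 + 0) *: p.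
    apply: cvgZr_tmp; apply: cvgD; [exact: cvg_cst|exact: cvg_id].
  by apply: (ct [set q | sqnorm q <= 4]); rewrite addr0 scale1r.
move=> /nbhs_ballP[e /= e0 /(_ (e / 2))].
rewrite /ball /= sub0r normrN gtr0_norm ?divr_gt0 // ltr_pdivrMr // ltr_pMr //.
rewrite ltr1n => /(_ isT); rewrite sqnormZ p4 => le4.
suff : 1 < (1 + e / 2) ^+ 2 by move=> ?; lra.
rewrite -[X in X < _](expr1n _ 2) ltrXn2r // ?nnegrE ?addr_ge0 ?divr_ge0 //; lra.
Qed.

Lemma compact_box n (M : R) :
  compact [set p : Cn R n | (forall j, `|p.1 0 j| <= M) /\ (forall j, `|p.2 0 j| <= M)].
Proof.
have cb : compact [set v : 'rV[R]_n | forall j, `[- M, M]%classic (v ord0 j)].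
  by apply: (@rV_compact _ _ (fun=> `[- M, M]%classic)) => _; exact: segment_compact.
set box := [set v : 'rV[R]_n | _] in cb.
rewrite (_ : [set p | _] = box `*` box); first exact: compact_setX.
apply/seteqP; split.
  by move=> [a b] /= [ha hb]; split=> j /=; rewrite in_itv /= -ler_norml.
by move=> [a b] /= [ha hb]; split=> j; have := ha j; have := hb j;
    rewrite /= !in_itv /= !ler_norml.
Qed.

Lemma compact_sqnorm_le (M : R) : compact [set p : Cn R 2 | sqnorm p <= M].
Proof.
have cl : closed [set p : Cn R 2 | sqnorm p <= M].
  by apply: closed_le_fun; exact: continuous_sqnorm.
apply: subclosed_compact cl (@compact_box 2 (Num.sqrt M)) _ => p /= pM.
have sq (a b : R) : 0 <= b -> a ^+ 2 + b <= M -> `|a| <= Num.sqrt M.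
  move=> b0 ab; rewrite -sqrtr_sqr ler_sqrt; first by lra.
  by have := sqr_ge0 a; lra.
have := pM; rewrite /sqnorm /sqn /= => h.
have := sqr_ge0 (p.1 0 0); have := sqr_ge0 (p.1 0 1); have := sqr_ge0 (p.2 0 0);
have := sqr_ge0 (p.2 0 1) => ? ? ? ?.
by split; apply: ord2P; [apply: (sq _ (M - p.1 0 0 ^+ 2))|apply: (sq _ (M - p.1 0 1 ^+ 2))|
  apply: (sq _ (M - p.2 0 0 ^+ 2))|apply: (sq _ (M - p.2 0 1 ^+ 2))]; lra.
Qed.

End Ball.

Ltac csmooth_tac :=
  repeat (first [ exact: csmooth_cst | exact: csmooth_ccoord | assumption
    | apply: csmoothB => // | apply: csmoothD => // | apply: csmoothN => //
    | apply: csmoothM => // | apply: csmoothX => // | apply: csmooth_conj => // ]).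

(** * The map and its local inverses *)

Section Differential.
Variable R : realType.

Lemma cdifferentiableB (E : normedModType R) (f g : E -> R[i]) x :
  cdifferentiable f x -> cdifferentiable g x -> cdifferentiable (fun x => f x - g x) x.
Proof.
move=> [fr fi] [gr gi]; split.
  by under eq_fun do rewrite ReD ReN; exact: differentiableB.
by under eq_fun do rewrite ImD ImN; exact: differentiableB.
Qed.

Lemma cDB (E : normedModType R) (f g : E -> R[i]) v x :
  cdifferentiable f x -> cdifferentiable g x ->
  cD v (fun x => f x - g x) x = cD v f x - cD v g x.
Proof.
move=> [fr fi] [gr gi]; apply: complex_ext; rewrite ?ReImE /=.
  by under eq_fun do rewrite ReD ReN; rewrite deriveB //; exact: diff_derivable.
by under eq_fun do rewrite ImD ImN; rewrite deriveB //; exact: diff_derivable.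
Qed.

Lemma smooth_Fmap_comp (E : normedModType R) (D : set E) (f : E -> Cn R 2) : open D ->
  (forall j, csmooth D (fun x => ccoord (f x) j)) -> smooth_on D (fun x => Fmap (f x)).
Proof.
move=> oD sf; have [s0 s1] := (sf 0, sf 1).
apply: smooth_vec => //; apply: ord3P.
- by under [X in csmooth _ X]eq_fun do rewrite Fmap0; csmooth_tac.
- by under [X in csmooth _ X]eq_fun do rewrite Fmap1; csmooth_tac.
- by under [X in csmooth _ X]eq_fun do rewrite Fmap2; csmooth_tac.
Qed.

Lemma smooth_Fmap D : open D -> smooth_on D (@Fmap R).
Proof.
by move=> oD; apply: (@smooth_Fmap_comp _ D idfun) => // j; exact: csmooth_ccoord.
Qed.

Lemma continuous_Fmap : continuous (@Fmap R).
Proof. by move=> p; exact: (smooth_Fmap openT 0%N). Qed.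

(** The differential of [Fmap] at any point with first coordinate [u], applied to [(a, b)]; see
    [diff_Fmap]. *)
Definition dF (u a b : R[i]) : Cn R 3 :=
  pt3 ((2 * u - 1) * a) b ((3 * u ^+ 2 - 2 * u) * a).

(* The derivatives [2u - 1] and [3u^2 - 2u] of the two coordinates depending on
   [u] generate the unit ideal. *)
Lemma bezout_F (u a : R[i]) :
  (6 * u - 1) * ((2 * u - 1) * a) - 4 * ((3 * u ^+ 2 - 2 * u) * a) = a.
Proof. ring. Qed.

Lemma dF_inj u a b a' b' : dF u a b = dF u a' b' -> a = a' /\ b = b'.
Proof.
move=> /pt3_inj[e0 -> e2]; split=> //.
by rewrite -(bezout_F u a) e0 e2 bezout_F.
Qed.

Lemma dF00 u : dF u 0 0 = 0.
Proof. by apply: ccoordP; apply: ord3P; rewrite ptE ccoord0 ?mulr0. Qed.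

Variables (E : normedModType R) (f : E -> Cn R 2) (x v : E).
Hypothesis du : cdifferentiable (fun x => ccoord (f x) 0) x.
Hypothesis dv : cdifferentiable (fun x => ccoord (f x) 1) x.

Let u := fun x => ccoord (f x) 0.
Let du1 : cdifferentiable (fun x => u x - 1) x.
Proof. by apply: cdifferentiableB => //; exact: cdifferentiable_cst. Qed.
Let du2 : cdifferentiable (fun x => u x * u x) x.
Proof. exact: cdifferentiableM. Qed.

Lemma differentiable_Fmap_comp : differentiable (fun y => Fmap (f y)) x.
Proof.
apply: differentiable_vec; apply: ord3P.
- under [X in cdifferentiable X]eq_fun do rewrite Fmap0.
  exact: (cdifferentiableM du du1).
- by under [X in cdifferentiable X]eq_fun do rewrite Fmap1.
- under [X in cdifferentiable X]eq_fun do rewrite Fmap2 expr2.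
  exact: (cdifferentiableM du2 du1).
Qed.

Lemma derive_Fmap_comp : 'D_v (fun y => Fmap (f y)) x =
  dF (ccoord (f x) 0) (cD v (fun x => ccoord (f x) 0) x) (cD v (fun x => ccoord (f x) 1) x).
Proof.
have d1 : cD v (fun x => u x - 1) x = cD v u x.
  by rewrite (cDB _ du (cdifferentiable_cst 1 x)) cD_cst subr0.
apply: ccoordP; apply: ord3P; rewrite [LHS](ccoord_derive _ _ differentiable_Fmap_comp) ptE.
- under [X in cD _ X]eq_fun do rewrite Fmap0.
  rewrite (cDM _ du du1) d1 -/(u x); ring.
- by under [X in cD _ X]eq_fun do rewrite Fmap1.
- under [X in cD _ X]eq_fun do rewrite Fmap2 expr2.
  rewrite (cDM _ du2 du1) d1 (cDM _ du du) -/(u x); ring.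
Qed.

End Differential.

Section FmapDifferential.
Variable R : realType.
Implicit Types (p v : Cn R 2).

Lemma differentiable_Fmap p : differentiable (@Fmap R) p.
Proof. exact: smooth_on_differentiable (smooth_Fmap openT) I. Qed.

Lemma diff_Fmap p v : 'd (@Fmap R) p v = dF (ccoord p 0) (ccoord v 0) (ccoord v 1).
Proof.
have cd j : cdifferentiable (fun p => ccoord p j) p.
  exact: csmooth_differentiable (csmooth_ccoord setT j) I.
rewrite -deriveE; last exact: differentiable_Fmap.
have := @derive_Fmap_comp R _ idfun p v (cd 0) (cd 1).
by rewrite /idfun !cD_ccoord.
Qed.

Lemma holomorphic_Fmap : holomorphic_on setT (@Fmap R).
Proof.
move=> p _; split; first exact: differentiable_Fmap.
move=> v; rewrite !diff_Fmap; apply: ccoordP; apply: ord3P;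
  rewrite !ccoord_mulI /dF !ptE; ring.
Qed.

Lemma diff_Fmap_inj p v : 'd (@Fmap R) p v = 0 -> v = 0.
Proof.
rewrite diff_Fmap -(dF00 (ccoord p 0)) => /dF_inj[v0 v1].
by apply: ccoordP; apply: ord2P; rewrite ccoord0.
Qed.

End FmapDifferential.

Section LocalInverse.
Variable R : realType.

Implicit Types (q : Cn R 2) (p : Cn R 3).

Lemma sqr_lt1 (x : R) : (x ^+ 2 < 1) = (-1 < x < 1).
Proof. by rewrite -real_normK ?num_real // expr_lt1 // ltr_norml. Qed.

Lemma Fmap0_eq0 q : (ccoord (Fmap q) 0 == 0) = (ccoord q 0 == 0) || (ccoord q 0 == 1).
Proof. by rewrite Fmap0 mulf_eq0 subr_eq0. Qed.

Lemma open_coord_neq0 n (j : 'I_n) : open [set p : Cn R n | ccoord p j != 0].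
Proof.
have c0 : continuous (fun p : Cn R n => sqn (ccoord p j)).
  by move=> p; exact: (smooth_sqn openT (csmooth_ccoord setT j) 0%N).
rewrite (_ : [set p | _] = [set p : Cn R n | setT p /\ 0 < sqn (ccoord p j)]).
  by apply: open_lt_fun => [|p _|p _]; [exact: openT|exact: cvg_cst|exact: c0].
by apply/seteqP; split=> p /=; rewrite sqn_gt0 // => -[].
Qed.

Definition Uquot p := ccoord p 2 / ccoord p 0.

Lemma csmooth_Uquot : csmooth [set p | ccoord p 0 != 0] Uquot.
Proof.
have oO := @open_coord_neq0 3 0.
apply: csmoothM => //; first exact: csmooth_ccoord.
by apply: csmoothV => //; exact: csmooth_ccoord.
Qed.

Lemma UquotK q : ccoord (Fmap q) 0 != 0 -> Uquot (Fmap q) = ccoord q 0.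
Proof.
move=> x0; rewrite /Uquot; apply: (mulIf x0); rewrite mulfVK //.
by rewrite Fmap0 Fmap2; ring.
Qed.

(** A neighbourhood of x = 0 on which the principal root of the discriminant 1 + 4x of u^2 - u - x
    is smooth. *)
Definition root_domain := [set p : Cn R 3 | 0 < Re (1 + 4 * ccoord p 0)].

Lemma open_root_domain : open root_domain.
Proof.
have sx : csmooth setT (fun p : Cn R 3 => 1 + 4 * ccoord p 0).
  by have oT := @openT (Cn R 3); csmooth_tac.
rewrite (_ : root_domain = [set p : Cn R 3 | setT p /\ 0 < Re (1 + 4 * ccoord p 0)]).
  apply: open_lt_fun => [|p _|p _]; [exact: openT|exact: cvg_cst|].
  by have [/(_ 0%N) sr _] := sx; exact: sr.
by apply/seteqP; split=> p //= -[].
Qed.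

(* The two solutions [u] of [u (u - 1) = x]. *)
Definition Uroot (e : R[i]) p := (1 + e * sqrtc (1 + 4 * ccoord p 0)) / 2.

Lemma csmooth_Uroot e : csmooth root_domain (Uroot e).
Proof.
have oO := open_root_domain.
apply: csmoothM => //; last exact: csmooth_cst.
apply: csmoothD => //; first exact: csmooth_cst.
apply: csmoothM => //; first exact: csmooth_cst.
by apply: csmooth_sqrt => //; csmooth_tac.
Qed.

(** For x = u (u - 1) one has 1 + 4x = (2u - 1)^2 = (e (2u - 1))^2, and the positive real part
    identifies e (2u - 1) as the principal root. *)
Lemma UrootK e q : e ^+ 2 = 1 -> 0 < Re (e * (2 * ccoord q 0 - 1)) ->
  Uroot e (Fmap q) = ccoord q 0.
Proof.
move=> e2 rp; rewrite /Uroot Fmap0.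
rewrite (_ : 1 + 4 * _ = (e * (2 * ccoord q 0 - 1)) ^+ 2); last by rewrite exprMn e2; ring.
rewrite sqrtcK // mulrA -expr2 e2.
by field.
Qed.

Lemma UrootKP e p : e ^+ 2 = 1 -> Uroot e p * (Uroot e p - 1) = ccoord p 0.
Proof.
move=> e2; have s2 := sqr_sqrtc (1 + 4 * ccoord p 0).
have := congr2 *%R e2 s2; rewrite mul1r /Uroot => h.
set s := sqrtc _ in s2 h *.
have -> : (1 + e * s) / 2 * ((1 + e * s) / 2 - 1) = (e ^+ 2 * s ^+ 2 - 1) / 4 by field.
by rewrite h; field.
Qed.

Lemma open_coord_lt (O : set (Cn R 3)) (j : 'I_3) (a : R) : open O ->
  open [set p | O p /\ sqn (ccoord p j) < a].
Proof.
move=> oO; apply: open_lt_fun => // p _; last exact: cvg_cst.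
exact: (smooth_sqn openT (csmooth_ccoord setT j) 0%N).
Qed.

Lemma open_coord_gt (O : set (Cn R 3)) (j : 'I_3) (a : R) : open O ->
  open [set p | O p /\ a < sqn (ccoord p j)].
Proof.
move=> oO; apply: open_lt_fun => // p _; first exact: cvg_cst.
exact: (smooth_sqn openT (csmooth_ccoord setT j) 0%N).
Qed.

(** The formula for u has to be right at every point of the sphere whose image lies in [O], so near
    x = 0 the set [O] must keep away from the other sheet. The bound 15/4 on |v|^2 lies between the
    values 3 and 4 taken at (1, t) and (0, t). *)
Lemma local_inverse q0 : sphereS q0 ->
  exists (O : set (Cn R 3)) (U : Cn R 3 -> R[i]),
    [/\ open O, O (Fmap q0), csmooth O U &
        forall q, sphereS q -> O (Fmap q) -> U (Fmap q) = ccoord q 0].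
Proof.
rewrite sphereSE /= => q04.
have [x0|x0] := eqVneq (ccoord (Fmap q0) 0) 0; last first.
  exists [set p | ccoord p 0 != 0], Uquot; split=> //.
  - exact: open_coord_neq0.
  - exact: csmooth_Uquot.
  - by move=> q _ x1; exact: UquotK.
have r0 : 0 < Re (1 + 4 * ccoord (Fmap q0) 0) by rewrite x0 mulr0 addr0 Re1.
move: (x0) => /eqP; rewrite Fmap0_eq0 => /orP[/eqP u0|/eqP u1].
  (* On the sphere |v|^2 > 15/4 means |u|^2 < 1/4, hence Re u < 1/2, which selects the root with
     sign -1. *)
  exists [set p | root_domain p /\ 15 / 4 < sqn (ccoord p 1)], (Uroot (- 1)); split.
  - exact: open_coord_gt open_root_domain.
  - split=> //=; rewrite Fmap1; move: q04; rewrite /sqnorm u0 /sqn !ReImE; lra.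
  - by apply: csmooth_subset (csmooth_Uroot _) => p [].
  - move=> q q4 [_]; rewrite Fmap1 => v4; apply: UrootK; first by rewrite sqrrN expr1n.
    rewrite !ReImE; move: q4 v4; rewrite /sqnorm /sqn => q4 v4.
    have : (2 * Re (ccoord q 0)) ^+ 2 < 1 by have := sqr_ge0 (Im (ccoord q 0)); lra.
    by rewrite sqr_lt1 => /andP[? ?]; lra.
(* Now |u|^2 > 1/4, so |x|^2 = |u|^2 |u - 1|^2 < 1/16 forces |u - 1|^2 < 1/4, hence Re u > 1/2,
   which selects the root with sign 1. *)
exists [set p | (root_domain p /\ sqn (ccoord p 1) < 15 / 4) /\ sqn (ccoord p 0) < 1 / 16],
  (Uroot 1); split.
- by do 2!apply: open_coord_lt; exact: open_root_domain.
- rewrite /= x0 Fmap1; split; last by rewrite /sqn /= ; lra.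
  by split=> //; move: q04; rewrite /sqnorm u1 /sqn !ReImE; lra.
- by apply: csmooth_subset (csmooth_Uroot _) => p [[]].
- move=> q q4 [[_]]; rewrite Fmap1 Fmap0 sqnM => v4 xlt.
  apply: UrootK; first by rewrite expr1n.
  move: q4; rewrite /sqnorm => q4.
  have u14 : 1 / 4 < sqn (ccoord q 0) by lra.
  have : sqn (ccoord q 0 - 1) < 1 / 4.
    rewrite ltNge; apply/negP => ge14.
    have := ler_pM _ _ (ltW u14) ge14; lra.
  rewrite /sqn !ReImE => h.
  have : (2 * (Re (ccoord q 0) - 1)) ^+ 2 < 1 by have := sqr_ge0 (Im (ccoord q 0)); lra.
  by rewrite sqr_lt1 => /andP[? ?]; lra.
Qed.

End LocalInverse.

Arguments ccoord : simpl never.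
Arguments conjc : simpl never.

(** * Embedding of the sphere and tangent spaces of its image *)

Section Embeddings.
Variable R : realType.
Implicit Types (q : Cn R 2) (p : Cn R 3).

Definition inv_with (U : Cn R 3 -> R[i]) p : Cn R 2 := pt2 (U p) (ccoord p 1).

Lemma smooth_inv_with (O : set (Cn R 3)) U : open O -> csmooth O U ->
  smooth_on O (inv_with U).
Proof.
move=> oO sU; apply: smooth_vec => //; apply: ord2P.
  by under [X in csmooth _ X]eq_fun do rewrite ptE.
by under [X in csmooth _ X]eq_fun do rewrite ptE; exact: csmooth_ccoord.
Qed.

Lemma inv_withK U q : U (Fmap q) = ccoord q 0 -> inv_with U (Fmap q) = q.
Proof. by move=> Uq; rewrite [RHS]pt2P /inv_with Uq Fmap1. Qed.

(** [Fmap] is an immersion everywhere and v is the coordinate y of the image, so only u has to be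
    recovered smoothly. *)
Lemma smooth_embedding_Fmap (A : set (Cn R 2)) :
  (forall q, A q -> exists (O : set (Cn R 3)) (U : Cn R 3 -> R[i]),
    [/\ open O, O (Fmap q), csmooth O U &
      forall q, A q -> O (Fmap q) -> U (Fmap q) = ccoord q 0]) ->
  smooth_embedding A (@Fmap R).
Proof.
move=> linv; split.
- by exists setT; split=> //; [exact: openT|exact: smooth_Fmap openT].
- by move=> q v _ _; exact: diff_Fmap_inj.
- apply: topological_embedding_local_inverse => [q _|q Aq].
    exact: continuous_Fmap.
  have [W [U [oW Wq sU UK]]] := linv q Aq.
  exists (inv_with U).
    exact: (smooth_inv_with oW sU 0%N).
  have : \forall p \near Fmap q, W p by exact: open_nbhs_nbhs.
  by apply: filterS => p Op q' Aq' q'p; rewrite -q'p inv_withK // UK // q'p.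
Qed.

Lemma line_embedding (c : R[i]) :
  smooth_embedding
    ([set p | ccoord p 1 = c] `\` [set cvec 2 [:: 0; c]; cvec 2 [:: 1; c]]) (@Fmap R).
Proof.
apply: smooth_embedding_Fmap => q [/= qc nq].
exists [set p | ccoord p 0 != 0], (@Uquot R); split.
- exact: open_coord_neq0.
- rewrite /= Fmap0_eq0; apply/negP => /orP[/eqP u0|/eqP u1]; apply: nq.
    by left; rewrite [q]pt2P qc u0.
  by right; rewrite /= [q]pt2P qc u1.
- exact: csmooth_Uquot.
- by move=> q' _; exact: UquotK.
Qed.

Lemma sphere_embedding : smooth_embedding (@sphereS R) (@Fmap R).
Proof. apply: smooth_embedding_Fmap; exact: local_inverse. Qed.

Lemma Fmap_inj_sphere q q' : sphereS q -> sphereS q' -> Fmap q = Fmap q' -> q = q'.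
Proof.
move=> Sq Sq' e; have [W [U [_ Wq _ UK]]] := local_inverse Sq.
rewrite -(inv_withK (UK q Sq Wq)) e inv_withK // UK // -e //.
Qed.

(** The curve is ((1 - k t^2) q + t (a, b)) / (1 + k t^2). Real orthogonality of (a, b) to q kills
    the cross term, and 4 (1 - k t^2)^2 + t^2 |(a, b)|^2 = 4 (1 + k t^2)^2 determines k = |(a, b)|^2
    / 16. Being rational without poles, the curve is smooth on the whole line, including the case
    (a, b) = 0. *)
Lemma sphere_curve q (a b : R[i]) : sqnorm q = 4 ->
  Re (a * conjc (ccoord q 0) + b * conjc (ccoord q 1)) = 0 ->
  exists s : R^o -> Cn R 2,
    [/\ s 0 = q, forall j, csmooth setT (fun t => ccoord (s t) j), forall t, sqnorm (s t) = 4,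
      cD (1 : R^o) (fun t => ccoord (s t) 0) 0 = a & cD (1 : R^o) (fun t => ccoord (s t) 1) 0 = b].
Proof.
set u := ccoord q 0; set v := ccoord q 1 => q4 tan.
pose k := (sqn a + sqn b) / 16.
have k0 : 0 <= k by rewrite divr_ge0 // addr_ge0 // sqn_ge0.
pose d t : R := 1 + k * (t * t).
have d0 t : 0 < d t by rewrite ltr_pwDl // mulr_ge0 // -expr2 sqr_ge0.
pose h (w c : R[i]) (t : R^o) : R[i] :=
  (w * (1 - k * (t * t))%:C%C + c * t%:C%C) * ((d t)^-1)%:C%C.
have oT := @openT R^o.
have sid : smooth_on setT (fun t : R^o => t : R).
  exact: (@smooth_on_linear _ _ _ setT (idfun : {linear R^o -> R}) (fun x => cvg_id)).
have scst (c : R) : smooth_on setT (fun _ : R^o => c : R) by move=> i; exact: Ck_on_cst.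
have sk : smooth_on setT (fun t : R^o => k * (t * t)).
  by move=> i; exact: (Ck_onM oT (scst k i) (Ck_onM oT (sid i) (sid i))).
have sd : smooth_on setT (d : R^o -> R) by move=> i; exact: (Ck_onD oT (scst 1 i) (sk i)).
have s1 : smooth_on setT (fun t : R^o => 1 - k * (t * t)).
  move=> i; apply: (eq_Ck_on oT _ (Ck_onD oT (scst 1 i) (Ck_onM oT (scst (-1) i) (sk i)))).
  by move=> t _; rewrite !fctE mulN1r.
have sh w c : csmooth setT (h w c).
  apply: csmoothM => //; last first.
    by apply: csmooth_real => //; apply: smoothV => // t _; rewrite gt_eqF.
  apply: csmoothD => //; apply: csmoothM => //; try exact: csmooth_cst.
    exact: csmooth_real.
  exact: csmooth_real.
have hM w c t : h w c t * (d t)%:C%C = w * (1 - k * (t * t))%:C%C + c * t%:C%C.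
  have dt := lt0r_neq0 (d0 t).
  by apply: complex_ext; rewrite /h !ReImE /=; field.
have hM' w c (t : R^o) : h w c t * (1 + k%:C%C * (t%:C%C * t%:C%C)) =
    w * (1 - k%:C%C * (t%:C%C * t%:C%C)) + c * t%:C%C.
  by have := hM w c t; rewrite /d rmorphB !rmorphD !rmorphM rmorph1.
have h0 w c : h w c 0 = w.
  have d00 : d 0 = 1 by rewrite /d !mulr0 addr0.
  by have := hM w c 0; rewrite d00 !mulr0 subr0 addr0 !mulr1.
pose tC (t : R^o) : R[i] := t%:C%C; pose K t := k%:C%C * (tC t * tC t).
have cdt : cdifferentiable tC 0.
  exact: csmooth_differentiable (csmooth_real oT sid) I.
have cdtt := cdifferentiableM cdt cdt.
have cdk := cdifferentiable_cst k%:C%C (0 : R^o).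
have cd1 := cdifferentiable_cst (1 : R[i]) (0 : R^o).
have cdK : cdifferentiable K 0 by exact: cdifferentiableM.
have dt0 : cD (1 : R^o) tC 0 = 1.
  by rewrite /cD /tC /= derive_cst derive_id.
have dK0 : cD (1 : R^o) K 0 = 0.
  rewrite [LHS](cDM _ cdk cdtt) cD_cst mul0r add0r (cDM _ cdt cdt) dt0.
  by rewrite mul1r mulr1 addr0 mulr0.
have dh w c : cD (1 : R^o) (h w c) 0 = c.
  have cdw := cdifferentiable_cst w (0 : R^o).
  have cdc := cdifferentiable_cst c (0 : R^o).
  have cdh : cdifferentiable (h w c) 0 by exact: csmooth_differentiable (sh w c) I.
  (* Differentiating this product relation at 0, where [K] and its derivative vanish, replaces the
     quotient rule. *)
  have eqh : (fun t => h w c t * (1 + K t)) = (fun t => w * (1 - K t) + c * tC t).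
    by apply/funext => t; rewrite -[RHS]/(w * (1 - K t) + c * tC t) -hM' //.
  have := congr1 (fun f => cD (1 : R^o) f 0) eqh.
  rewrite /= (cDM _ cdh (cdifferentiableD cd1 cdK)) (cDD _ cd1 cdK).
  rewrite (cDD _ (cdifferentiableM cdw (cdifferentiableB cd1 cdK)) (cdifferentiableM cdc cdt)).
  rewrite (cDM _ cdw (cdifferentiableB cd1 cdK)) (cDB _ cd1 cdK) (cDM _ cdc cdt).
  rewrite !cD_cst dK0 dt0 /K /tC !mul0r !mulr0 !addr0 !subr0 !mulr0 !mulr1 !add0r.
  by rewrite addr0.
exists (fun t => pt2 (h u a t) (h v b t)); split.
- by rewrite !h0 [RHS]pt2P.
- by apply: ord2P; under [X in csmooth _ X]eq_fun do rewrite ptE.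
- move=> t; rewrite sqnorm_pt2.
  have dt := lt0r_neq0 (d0 t).
  have -> : sqn (h u a t) + sqn (h v b t) =
    ((1 - k * (t * t)) ^+ 2 * (sqn u + sqn v) + t ^+ 2 * (sqn a + sqn b) +
     2 * t * (1 - k * (t * t)) * Re (a * conjc u + b * conjc v)) / d t ^+ 2.
    by rewrite /sqn /h !ReImE /=; field.
  rewrite tan -[sqn u + sqn v]/(sqnorm q) q4 mulr0 addr0.
  rewrite (_ : sqn a + sqn b = 16 * k); last by rewrite /k; field.
  by rewrite /d in dt *; field.
- by under [X in cD _ X]eq_fun do rewrite ptE; exact: dh.
- by under [X in cD _ X]eq_fun do rewrite ptE; exact: dh.
Qed.

Definition boundary : set (Cn R 3) := @Fmap R @` @sphereS R.

Lemma smooth_continuous (E G : normedModType R) (f : E -> G) (D : set E) x :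
  smooth_on D f -> D x -> {for x, continuous f}.
Proof. by move=> /(_ 0%N); apply. Qed.

Lemma sqnE (z : R[i]) : (sqn z)%:C%C = z * conjc z.
Proof. by apply: complex_ext; rewrite ?ReImE /= /sqn; ring. Qed.

(** A curve in the image lifts near 0, through the local inverse, to a curve on the sphere, and the
    equation u conj u + v conj v = 4 is differentiated along the lift. Conversely, the curves of
    [sphere_curve] are pushed forward by [Fmap]. *)
Lemma tangent_boundary q : sqnorm q = 4 ->
  tangent boundary (Fmap q) = [set w | exists a b, w = dF (ccoord q 0) a b /\
    Re (a * conjc (ccoord q 0) + b * conjc (ccoord q 1)) = 0].
Proof.
move=> q4; have Sq : sphereS q by rewrite sphereSE.
apply/seteqP; split=> w /=.
  move=> [D [gamma [[oD D0] sg gM g0 <-]]].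
  have [W [U [oW Wq sU UK]]] := local_inverse Sq.
  have dg : differentiable (gamma : R^o -> Cn R 3) 0.
    exact: smooth_on_differentiable sg D0.
  have cg : {for (0 : R^o), continuous (gamma : R^o -> Cn R 3)}.
    exact: smooth_continuous sg D0.
  pose u (t : R^o) := U (gamma t); pose y (t : R^o) := ccoord (gamma t) 1.
  have nD : \forall t \near (0 : R^o), D t by exact: open_nbhs_nbhs.
  have nW : \forall t \near (0 : R^o), W (gamma t).
    by apply: (cg W); rewrite g0; exact: open_nbhs_nbhs.
  have lift_g : \forall t \near (0 : R^o),
      exists2 q', sqnorm q' = 4 & gamma t = Fmap q' /\ q' = pt2 (u t) (y t).
    apply: filterS2 nD nW => t Dt Wt.
    have [q' Sq' q't] : boundary (gamma t) by apply: gM; exists t.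
    exists q'; first by move: Sq'; rewrite sphereSE.
    by split=> //; rewrite /u /y -q't UK ?q't // -q't Fmap1 -pt2P.
  have cdu : cdifferentiable u 0.
    apply: (cdifferentiable_comp dg); apply: csmooth_differentiable sU _.
    by rewrite g0.
  have cdy : cdifferentiable y 0 by exact: differentiable_ccoord.
  have u0 : u 0 = ccoord q 0 by rewrite /u g0 UK.
  have y0 : y 0 = ccoord q 1 by rewrite /y g0 Fmap1.
  exists (cD (1 : R^o) u 0), (cD (1 : R^o) y 0); split.
    rewrite derive1E.
    have -> : 'D_1 gamma 0 = 'D_(1 : R^o) (fun t : R^o => Fmap (pt2 (u t) (y t))) 0.
      by apply: near_eq_derive; apply: filterS lift_g => t [q' _ [-> <-]].
    rewrite derive_Fmap_comp.
    - rewrite ptE u0.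
      by congr dF; [under eq_fun do rewrite ptE|under eq_fun do rewrite ptE].
    - by under [X in cdifferentiable X]eq_fun do rewrite ptE.
    - by under [X in cdifferentiable X]eq_fun do rewrite ptE.
  have cuu := cdifferentiableM cdu (cdifferentiable_conj cdu).
  have cyy := cdifferentiableM cdy (cdifferentiable_conj cdy).
  have : cD (1 : R^o) (fun t => u t * conjc (u t) + y t * conjc (y t)) 0 = 0.
    rewrite -(cD_cst (4 : R[i]) (1 : R^o) 0); apply: near_eq_cD.
    apply: filterS lift_g => t [q' q'4 [_ q'E]].
    rewrite -!sqnE -rmorphD /= -sqnorm_pt2 -q'E q'4.
    by apply: complex_ext; rewrite ?ReImE.
  rewrite (cDD _ cuu cyy) (cDM _ cdu (cdifferentiable_conj cdu)).
  rewrite (cDM _ cdy (cdifferentiable_conj cdy)) !cD_conj // u0 y0.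
  move=> /(congr1 (@complex.Re R)); rewrite !ReImE => ?; lra.
move=> [a [b [-> ab0]]].
have [s [s0 ss s4 sa sb]] := sphere_curve q4 ab0.
have cd j : cdifferentiable (fun t => ccoord (s t) j) (0 : R^o).
  exact: csmooth_differentiable (ss j) I.
have sF := smooth_Fmap_comp (@openT R^o) ss.
exists setT, (fun t => Fmap (s t)); split => //.
- by split=> //; exact: openT.
- by move=> _ [t _ <-]; exists (s t); [rewrite sphereSE; exact: s4|].
- by rewrite s0.
- rewrite derive1E -[LHS]/('D_(1 : R^o) (fun t : R^o => Fmap (s t)) 0).
  by rewrite derive_Fmap_comp // sa sb s0.
Qed.

Lemma mulI_dF u a b : mulI (dF u a b : Cn R 3) = dF u ('i%C * a) ('i%C * b).
Proof. by apply: ccoordP; apply: ord3P; rewrite ccoord_mulI /dF !ptE; ring. Qed.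

(** By [mulI_dF] multiplication by i acts on the pair (a, b). Imposing the real condition on (a, b)
    and on -i (a, b) makes both the real and the imaginary part of the Hermitian product with [q]
    vanish. *)
Lemma holomorphic_tangent_boundary q : sqnorm q = 4 ->
  holomorphic_tangent boundary (Fmap q) = [set w | exists a b, w = dF (ccoord q 0) a b /\
    a * conjc (ccoord q 0) + b * conjc (ccoord q 1) = 0].
Proof.
move=> q4; rewrite /holomorphic_tangent tangent_boundary //.
apply/seteqP; split=> w /=.
  move=> [[a [b [wE ab]]] [w' [a' [b' [w'E ab']]] Jw']].
  exists a, b; split=> //.
  move: Jw'; rewrite wE w'E mulI_dF => /dF_inj[aE bE].
  apply: complex_ext => //; move: ab'; rewrite -aE -bE !ReImE /= => ?; lra.
move=> [a [b [wE ab]]]; split.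
  by exists a, b; rewrite ab.
exists (dF (ccoord q 0) (- 'i%C * a) (- 'i%C * b)).
  exists (- 'i%C * a), (- 'i%C * b); split=> //.
  by rewrite -!mulrA -mulrDr ab mulr0.
by rewrite mulI_dF wE !mulrA mulrN -expr2 sqr_i opprK !mul1r.
Qed.

Lemma orthogonal_sphere q (a b : R[i]) : sqnorm q = 4 ->
  a * conjc (ccoord q 0) + b * conjc (ccoord q 1) = 0 ->
  exists c, a = c * - conjc (ccoord q 1) /\ b = c * conjc (ccoord q 0).
Proof.
set u := ccoord q 0; set v := ccoord q 1 => q4 ab.
have q4' : u * conjc u + v * conjc v = 4.
  by rewrite -!sqnE -rmorphD /= -/(sqnorm q) q4; apply: complex_ext; rewrite ?ReImE.
have n4 : (4 : R[i]) != 0 by [].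
(* The Hermitian product of (a, b) with (- conj v, conj u), divided by the squared norm 4 of the
   latter. *)
exists ((b * u - a * v) / 4); split; apply: (mulfI n4).
- have -> : 4 * ((b * u - a * v) / 4 * - conjc v) =
    a * (v * conjc v) - u * (b * conjc v) by field.
  have -> : b * conjc v = - (a * conjc u) by apply/eqP; rewrite -addr_eq0 addrC ab.
  by rewrite -q4'; ring.
- have -> : 4 * ((b * u - a * v) / 4 * conjc u) =
    b * (u * conjc u) - v * (a * conjc u) by field.
  have -> : a * conjc u = - (b * conjc v) by apply/eqP; rewrite -addr_eq0 ab.
  by rewrite -q4'; ring.
Qed.

Lemma has_cdim_holomorphic_tangent p : boundary p ->
  has_cdim 1 (holomorphic_tangent boundary p).
Proof.
move=> [q]; rewrite sphereSE /= => q4 <-.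
rewrite holomorphic_tangent_boundary //.
set u := ccoord q 0; set v := ccoord q 1.
have combE (c : 'rV[R[i]]_1) :
    ccomb (fun _ => dF u (- conjc v) (conjc u)) c =
    dF u (c 0 0 * - conjc v) (c 0 0 * conjc u).
  rewrite /ccomb big_ord1; apply: ccoordP; apply: ord3P;
    by rewrite ccoord_cscale /dF !ptE; ring.
exists (fun _ => dF u (- conjc v) (conjc u)).
  move=> c c'; rewrite !combE => /dF_inj[e1 e2].
  apply/rowP => j; rewrite ord1; apply/eqP; rewrite -subr_eq0; apply/negPn/negP => n0.
  have uv0 z : (c 0 0 - c' 0 0) * z = 0 -> z = 0.
    by move=> /eqP; rewrite mulf_eq0 (negPf n0) => /eqP.
  have v0 : - conjc v = 0 by apply: uv0; rewrite mulrBl e1 subrr.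
  have u0 : conjc u = 0 by apply: uv0; rewrite mulrBl e2 subrr.
  move: q4; rewrite /sqnorm -/u -/v -(sqn_conj u) -(sqn_conj v) u0 -(sqnN (conjc v)) v0.
  by rewrite /sqn !ReImE => h; clear -h; lra.
apply/seteqP; split=> w /=.
  move=> [a [b [-> ab]]]; have [c [-> ->]] := orthogonal_sphere q4 ab.
  by exists (\row_ _ c) => //; rewrite combE !mxE.
move=> [c _ <-]; rewrite combE; exists (c 0 0 * - conjc v), (c 0 0 * conjc u).
by split=> //; ring.
Qed.

End Embeddings.

Lemma Complex_inj (R : realType) (a b c d : R) :
  Complex a b = Complex c d -> a = c /\ b = d.
Proof. by case. Qed.

(** * Stereographic charts of the sphere of radius 2 *)

Section Stereographic.
Variables (R : realType) (e : R).
Hypothesis e2 : e ^+ 2 = 1.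
Implicit Types (w h : 'rV[R]_3) (q : Cn R 2).

Definition row_coord i w : R := w 0 i.

Lemma row_coord_is_linear i : linear (row_coord i).
Proof. by move=> a u v; rewrite /row_coord !mxE. Qed.
HB.instance Definition _ i :=
  GRing.isLinear.Build R 'rV[R]_3 R _ (row_coord i) (row_coord_is_linear i).

Lemma smooth_row_coord D i : smooth_on D (row_coord i).
Proof. by apply: smooth_on_linear; exact: coord_continuous. Qed.

Definition sqrow w : R := w 0 0 * w 0 0 + w 0 1 * w 0 1 + w 0 2 * w 0 2.

Lemma sqrow_ge0 w : 0 <= sqrow w.
Proof. by rewrite /sqrow -!expr2 !addr_ge0 // sqr_ge0. Qed.

Lemma sqrow1_neq0 w : 1 + sqrow w != 0.
Proof. by rewrite gt_eqF // ltr_pwDl // sqrow_ge0. Qed.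

(* Inverse stereographic projection from the pole [(2e, 0)] of the sphere. *)
Definition stereo w : Cn R 2 :=
  pt2 (Complex (2 * e * (sqrow w - 1) / (1 + sqrow w)) (4 * w 0 0 / (1 + sqrow w)))
      (Complex (4 * w 0 1 / (1 + sqrow w)) (4 * w 0 2 / (1 + sqrow w))).

Lemma sqnorm_stereo w : sqnorm (stereo w) = 4.
Proof.
have := sqrow1_neq0 w; rewrite sqnorm_pt2 /sqn /= => D0.
rewrite !expr_div_n -!mulrDl; apply: (mulIf (expf_neq0 2 D0)).
rewrite divfK ?expf_neq0 // !exprMn e2.
rewrite /sqrow; ring.
Qed.

(** This quantity is the denominator of the projection [unstereo]; on the sphere it vanishes only at
    the pole. *)
Lemma stereo_gap w : 2 - e * Re (ccoord (stereo w) 0) = 4 / (1 + sqrow w).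
Proof.
have D0 := sqrow1_neq0 w; rewrite ptE /=.
have -> : 2 - e * (2 * e * (sqrow w - 1) / (1 + sqrow w)) =
  2 - 2 * e ^+ 2 * (sqrow w - 1) / (1 + sqrow w) by field.
by rewrite e2; field.
Qed.

Lemma csmooth_stereo j : csmooth setT (fun w => ccoord (stereo w) j).
Proof.
have oT := @openT 'rV[R]_3.
have scst (c : R) : smooth_on setT (fun _ : 'rV[R]_3 => c : R) by move=> i; exact: Ck_on_cst.
have sc i := @smooth_row_coord setT i.
have sN : smooth_on setT sqrow.
  move=> k; exact: (Ck_onD oT (Ck_onD oT (Ck_onM oT (sc 0 k) (sc 0 k))
    (Ck_onM oT (sc 1 k) (sc 1 k))) (Ck_onM oT (sc 2 k) (sc 2 k))).
have sV : smooth_on setT (fun w => (1 + sqrow w)^-1).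
  apply: smoothV => // [w _|k]; first exact: sqrow1_neq0.
  exact: (Ck_onD oT (scst 1 k) (sN k)).
have s4 i : smooth_on setT (fun w => 4 * w 0 i / (1 + sqrow w)).
  by move=> k; exact: (Ck_onM oT (Ck_onM oT (scst 4 k) (sc i k)) (sV k)).
have s0 : smooth_on setT (fun w => 2 * e * (sqrow w - 1) / (1 + sqrow w)).
  move=> k; exact: (Ck_onM oT (Ck_onM oT (scst (2 * e) k) (Ck_onD oT (sN k) (scst (-1) k))) (sV k)).
by move: j; apply: ord2P; under [X in csmooth _ X]eq_fun do rewrite ptE;
  split; first [exact: s0|exact: s4].
Qed.

Definition unstereo q : 'rV[R]_3 :=
  (Im (ccoord q 0) / (2 - e * Re (ccoord q 0))) *: delta_mx 0 0 +
  (Re (ccoord q 1) / (2 - e * Re (ccoord q 0))) *: delta_mx 0 1 +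
  (Im (ccoord q 1) / (2 - e * Re (ccoord q 0))) *: delta_mx 0 2.

Lemma unstereo0 q : unstereo q 0 0 = Im (ccoord q 0) / (2 - e * Re (ccoord q 0)).
Proof. by rewrite !mxE /= mulr1 !mulr0 !addr0. Qed.
Lemma unstereo1 q : unstereo q 0 1 = Re (ccoord q 1) / (2 - e * Re (ccoord q 0)).
Proof. by rewrite !mxE /= mulr1 !mulr0 !addr0 add0r. Qed.
Lemma unstereo2 q : unstereo q 0 2 = Im (ccoord q 1) / (2 - e * Re (ccoord q 0)).
Proof. by rewrite !mxE /= mulr1 !mulr0 !add0r. Qed.

Lemma stereo_coords w : [/\ w 0 0 * (2 - e * Re (ccoord (stereo w) 0)) = Im (ccoord (stereo w) 0),
  w 0 1 * (2 - e * Re (ccoord (stereo w) 0)) = Re (ccoord (stereo w) 1) &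
  w 0 2 * (2 - e * Re (ccoord (stereo w) 0)) = Im (ccoord (stereo w) 1)].
Proof. by have D0 := sqrow1_neq0 w; rewrite stereo_gap !ptE /=; split; field. Qed.

Lemma stereo_gap_neq0 w : 2 - e * Re (ccoord (stereo w) 0) != 0.
Proof. by rewrite stereo_gap mulf_neq0 // invr_neq0 // sqrow1_neq0. Qed.

Lemma stereoK : cancel stereo unstereo.
Proof.
move=> w; have g0 := stereo_gap_neq0 w; have [c0 c1 c2] := stereo_coords w.
apply/rowP; apply: ord3P.
- by rewrite unstereo0 -c0 mulfK.
- by rewrite unstereo1 -c1 mulfK.
- by rewrite unstereo2 -c2 mulfK.
Qed.

Lemma unstereoK q : sqnorm q = 4 -> e * Re (ccoord q 0) < 2 -> stereo (unstereo q) = q.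
Proof.
move=> q4 gap; have g0 : 2 - e * Re (ccoord q 0) != 0 by rewrite subr_eq0 gt_eqF.
set a := Re (ccoord q 0) in gap g0; set b := Im (ccoord q 0);
set c := Re (ccoord q 1); set d := Im (ccoord q 1).
have q4' : b ^+ 2 + c ^+ 2 + d ^+ 2 = 4 - a ^+ 2.
  by move: q4; rewrite /sqnorm /sqn -/a -/b -/c -/d => ?; lra.
have e2a : 4 - a ^+ 2 = (2 - e * a) * (2 + e * a).
  have -> : a ^+ 2 = e ^+ 2 * a ^+ 2 by rewrite e2 mul1r.
  ring.
have N : sqrow (unstereo q) = (2 + e * a) / (2 - e * a).
  rewrite /sqrow unstereo0 unstereo1 unstereo2 -/a -/b -/c -/d.
  rewrite (_ : _ + _ = (b ^+ 2 + c ^+ 2 + d ^+ 2) / (2 - e * a) ^+ 2); last by field.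
  by rewrite q4' e2a; field.
have N1 : 1 + sqrow (unstereo q) = 4 / (2 - e * a) by rewrite N; field.
have N2 : sqrow (unstereo q) - 1 = 2 * e * a / (2 - e * a) by rewrite N; field.
rewrite /stereo N1 N2 unstereo0 unstereo1 unstereo2 -/a -/b -/c -/d [RHS]pt2P.
congr pt2; apply: complex_ext => /=.
- by rewrite -[RHS]/a; transitivity (e ^+ 2 * a); [field|rewrite e2 mul1r].
- by rewrite -[RHS]/b; field.
- by rewrite -[RHS]/c; field.
- by rewrite -[RHS]/d; field.
Qed.

Lemma continuous_unstereo q : e * Re (ccoord q 0) < 2 -> {for q, continuous unstereo}.
Proof.
move=> gap; have oT := @openT (Cn R 2).
have scst (c : R) k : Ck_on k setT (fun _ : Cn R 2 => c : R) by exact: Ck_on_cst.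
have [r0 i0] := @csmooth_ccoord R 2 setT 0; have [r1 i1] := @csmooth_ccoord R 2 setT 1.
have sg k : Ck_on k setT (fun q : Cn R 2 => 2 - e * Re (ccoord q 0)).
  apply: (eq_Ck_on oT _ (Ck_onD oT (scst 2 k) (Ck_onM oT (scst (- e) k) (r0 k)))).
  by move=> p _; rewrite !fctE mulNr.
pose D := [set q : Cn R 2 | setT q /\ e * Re (ccoord q 0) < 2].
have oD : open D.
  apply: open_lt_fun => // p _; last exact: cvg_cst.
  exact: (Ck_onM oT (scst e 0%N) (r0 0%N)).
have sD (f : Cn R 2 -> R) : smooth_on setT f -> Ck_on 0 D f.
  by move=> sf; exact: (smooth_on_subset _ sf 0%N).
have sV : Ck_on 0 D (fun q : Cn R 2 => (2 - e * Re (ccoord q 0))^-1).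
  apply: Ck_onV => // [p [_ gp]|]; last exact: sD.
  by rewrite subr_eq0 gt_eqF.
have := Ck_onD oD (Ck_onD oD
  (Ck_onZl (delta_mx 0 0 : 'rV[R]_3) oD (Ck_onM oD (sD _ i0) sV))
  (Ck_onZl (delta_mx 0 1 : 'rV[R]_3) oD (Ck_onM oD (sD _ r1) sV)))
  (Ck_onZl (delta_mx 0 2 : 'rV[R]_3) oD (Ck_onM oD (sD _ i1) sV)).
by move=> /(_ q); apply.
Qed.

(** No Jacobian is computed. Each relation of [stereo_coords] has the form w_i * gap = f_i, with gap
    and f_i affine in the real coordinates of [stereo w]. If the derivatives of these coordinates
    along h and h' agree, the product rule leaves h_i * gap = h'_i * gap, and gap is nonzero. *)
Lemma derive_stereo_inj w h h' :
  (forall j, cD h (fun w => ccoord (stereo w) j) w = cD h' (fun w => ccoord (stereo w) j) w) ->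
  h = h'.
Proof.
move=> dhh.
have g0 := stereo_gap_neq0 w.
have [dr0 di0] := csmooth_differentiable (csmooth_stereo 0) (I : setT w).
have [dr1 di1] := csmooth_differentiable (csmooth_stereo 1) (I : setT w).
have dc i : differentiable (row_coord i) w.
  exact: smooth_on_differentiable (@smooth_row_coord setT i) I.
pose gap := fun w => 2 - e * Re (ccoord (stereo w) 0).
have dea : differentiable (fun w => e * Re (ccoord (stereo w) 0)) w.
  exact: (@differentiableZ _ _ _ (fun w => Re (ccoord (stereo w) 0)) e).
have dgap : differentiable gap w.
  by apply: differentiableB => //; exact: differentiable_cst.
have Dgap k : 'D_k gap w = - e * 'D_k (fun w => Re (ccoord (stereo w) 0)) w.
  rewrite deriveB; [|exact: derivable_cst|exact: diff_derivable].
  rewrite derive_cst sub0r mulNr; congr (- _).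
  have dd : derivable (fun w => Re (ccoord (stereo w) 0)) w k by exact: diff_derivable.
  exact: (deriveZ e dd).
have Dcoord i k : 'D_k (row_coord i) w = k 0 i.
  by rewrite deriveE // diff_lin //; exact: coord_continuous.
have key i (f : 'rV[R]_3 -> R) : (forall w, w 0 i * gap w = f w) ->
    'D_h f w = 'D_h' f w -> h 0 i = h' 0 i.
  move=> fE; have <- : row_coord i * gap = f by apply/funext => y; rewrite -fE.
  rewrite !deriveM; try exact: diff_derivable.
  rewrite !Dcoord !Dgap; have [-> _] := Complex_inj (dhh 0).
  by move=> /addrI /(mulfI g0).
have [[_ e0] [e1 e1']] := (Complex_inj (dhh 0), Complex_inj (dhh 1)).
apply/rowP; apply: ord3P.
- by apply: key e0 => y; have [] := stereo_coords y.
- by apply: key e1 => y; have [] := stereo_coords y.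
- by apply: key e1' => y; have [] := stereo_coords y.
Qed.

End Stereographic.

(** * The boundary as a strongly pseudoconvex hypersurface *)

Section CRManifold.
Variable R : realType.
Implicit Types (q : Cn R 2) (p : Cn R 3).

(** The sign e = 1 or -1 is chosen so that the pole (2e, 0) is not [q]. The chart covers the sphere
    minus the pole, so its image under [Fmap] is all of the boundary except one point. *)
Lemma sphere_chart q : sqnorm q = 4 ->
  exists (pole : Cn R 2) (st : 'rV[R]_3 -> Cn R 2) (T : Cn R 2 -> 'rV[R]_3),
    [/\ sqnorm pole = 4 /\ q <> pole,
        forall w, sqnorm (st w) = 4 /\ st w <> pole,
        cancel st T,
        forall q', sqnorm q' = 4 -> q' <> pole -> st (T q') = q' /\ {for q', continuous T} &
        (forall j, csmooth setT (fun w => ccoord (st w) j)) /\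
        (forall w h h', (forall j, cD h (fun w => ccoord (st w) j) w =
                                   cD h' (fun w => ccoord (st w) j) w) -> h = h')].
Proof.
move=> q4.
have [e e2 gap] : exists2 e : R, e ^+ 2 = 1 & e * Re (ccoord q 0) < 2.
  have [ge0|lt0] := lerP 0 (Re (ccoord q 0)).
    by exists (-1); [rewrite sqrrN expr1n|lra].
  by exists 1; [rewrite expr1n|lra].
pose pole : Cn R 2 := pt2 (Complex (2 * e) 0) 0.
have gap_pole (p : Cn R 2) : e * Re (ccoord p 0) < 2 -> p <> pole.
  move=> gp pE; move: gp; rewrite pE ptE /= mulrCA -expr2 e2.
  by rewrite mulr1 ltxx.
have st_gap w : e * Re (ccoord (stereo e w) 0) < 2.
  by rewrite -subr_gt0 (stereo_gap e2) divr_gt0 // ltr_pwDl // sqrow_ge0.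
have pole_gap (p : Cn R 2) : sqnorm p = 4 -> p <> pole -> e * Re (ccoord p 0) < 2.
  move=> p4 np; rewrite ltNge; apply/negP => ge2; apply: np.
  set a := Re (ccoord p 0) in ge2; set b := Im (ccoord p 0);
  set c := Re (ccoord p 1); set d := Im (ccoord p 1).
  move: p4; rewrite /sqnorm /sqn -/a -/b -/c -/d => p4.
  have a2 : (e * a) ^+ 2 = a ^+ 2 by rewrite exprMn e2 mul1r.
  (* Since a^2 + b^2 + c^2 + d^2 = 4, this leaves b = c = d = 0 and e a = 2, so the point is the
     pole. *)
  have a4 : 4 <= a ^+ 2 by rewrite -a2; nra.
  have [sb sc sd] := And3 (sqr_ge0 b) (sqr_ge0 c) (sqr_ge0 d).
  have zero x : x ^+ 2 = 0 -> x = 0 :> R by move=> /eqP; rewrite sqrf_eq0 => /eqP.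
  have b0 : b = 0 by apply: zero; lra.
  have c0 : c = 0 by apply: zero; lra.
  have d0 : d = 0 by apply: zero; lra.
  have ea2 : e * a = 2.
    have : (e * a - 2) * (e * a + 2) = 0 by rewrite -subr_sqr a2; lra.
    by move=> /eqP; rewrite mulf_eq0 => /orP[/eqP|/eqP] ?; lra.
  have a0 : a = 2 * e by rewrite -ea2 mulrAC -expr2 e2 mul1r.
  rewrite [LHS]pt2P; congr pt2; apply: complex_ext; rewrite ?ReImE.
  + exact: a0. + exact: b0. + exact: c0. + exact: d0.
exists pole, (stereo e), (unstereo e); split.
- by split; [rewrite sqnorm_pt2 /sqn /= exprMn e2; ring|exact: gap_pole].
- by move=> w; split; [exact: sqnorm_stereo|exact: gap_pole].
- exact: stereoK e2.
- move=> p p4 np; have gp := pole_gap p p4 np.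
  by split; [exact: unstereoK|exact: continuous_unstereo].
- by split; [exact: csmooth_stereo|exact: derive_stereo_inj e2].
Qed.

Lemma submanifold_boundary : submanifold 3 (@boundary R).
Proof.
move=> p [q Sq <-]; have q4 : sqnorm q = 4 by move: Sq; rewrite sphereSE.
have [pole [st [T [[pole4 qpole] stP stK unstK [sst dst]]]]] := sphere_chart q4.
have Spole : sphereS pole by rewrite sphereSE.
have Sst w : sphereS (st w) by rewrite sphereSE; exact: (stP w).1.
pose phi w := Fmap (st w).
have sphi : smooth_on setT phi by exact: (smooth_Fmap_comp openT sst).
(* As [Fmap] is injective on the sphere, removing the pole upstairs is the same as removing the
   single point [Fmap pole] from the image. *)
exists (~` [set Fmap pole]), setT, phi; split.
- split.
    by apply: closed_openC; apply: compact_closed; [exact: norm_hausdorff|exact: compact_set1].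
  by move=> /= Fqp; apply: qpole; exact: Fmap_inj_sphere Sq Spole Fqp.
- by split; [exact: openT|exact: sphi].
- move=> w _ h h' hh'; apply: (dst w) => j.
  have cd i := csmooth_differentiable (sst i) (I : setT w).
  have dphi := smooth_on_differentiable sphi (I : setT w).
  have dE k : 'd phi w k = dF (ccoord (st w) 0) (cD k (fun w => ccoord (st w) 0) w)
      (cD k (fun w => ccoord (st w) 1) w).
    by rewrite -(deriveE k dphi) (derive_Fmap_comp k (cd 0) (cd 1)).
  by move: hh'; rewrite !dE => /dF_inj[d0 d1]; move: j; apply: ord2P.
- apply: topological_embedding_local_inverse => [w _|w _].
    exact: smooth_continuous sphi I.
  have [W [U [oW Wq sU UK]]] := local_inverse (Sst w).
  have invK w' : W (phi w') -> inv_with U (phi w') = st w'.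
    by move=> Ww'; exact: inv_withK (UK _ (Sst w') Ww').
  exists (T \o inv_with U).
    apply: continuous_comp; first exact: smooth_continuous (smooth_inv_with oW sU) Wq.
    have [st4 npole] := stP w; have [_ cT] := unstK _ st4 npole.
    by rewrite (invK w Wq); exact: cT.
  have : \forall p \near phi w, W p by exact: open_nbhs_nbhs.
  apply: filterS => p' Wp' w' _ w'p' /=; rewrite -w'p' (invK w'); first exact: stK.
  by rewrite w'p'.
- apply/seteqP; split=> p'.
    move=> [w _ <-]; split; first by exists (st w); [exact: Sst|].
    move=> Fp; have [_ npole] := stP w.
    by apply: npole; exact: Fmap_inj_sphere (Sst w) Spole Fp.
  move=> [[q' Sq' <-] nq']; have q'4 : sqnorm q' = 4 by move: Sq'; rewrite sphereSE.
  have [q'E _] : st (T q') = q' /\ {for q', continuous T}.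
    by apply: unstK => // q'pole; apply: nq'; rewrite /= q'pole.
  by exists (T q') => //; rewrite /phi q'E.
Qed.

Lemma CR_manifold_boundary : CR_manifold 2 (@boundary R).
Proof.
by split; [exact: submanifold_boundary|exact: has_cdim_holomorphic_tangent].
Qed.

End CRManifold.

(** * The Levi form of the image of the sphere *)

Section LeviForm.
Variable R : realType.
Implicit Types (q : Cn R 2) (p w : Cn R 3).

(* The Hermitian product with [q] of the left inverse of the differential of
   [Fmap] at [q] given by [bezout_F]. *)
Definition normal_part q w : R[i] :=
  ((6 * ccoord q 0 - 1) * ccoord w 0 - 4 * ccoord w 2) * conjc (ccoord q 0) +
  ccoord w 1 * conjc (ccoord q 1).

Lemma normal_part_dF q a b : normal_part q (dF (ccoord q 0) a b) =
  a * conjc (ccoord q 0) + b * conjc (ccoord q 1).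
Proof. by rewrite /normal_part /dF !ptE bezout_F. Qed.

(** On tangent vectors the real part of [normal_part] vanishes, so there the imaginary part cuts out
    the holomorphic tangent space. The minus sign makes the Levi form positive. *)
Definition levi_covector q w : R := - Im (normal_part q w).

Lemma levi_covector_is_linear q : linear (levi_covector q).
Proof.
move=> c w w'; rewrite /levi_covector /normal_part !ccoordD !ccoordZ.
rewrite -[c *: _]/(c * _) !ReImE /=; ring.
Qed.
HB.instance Definition _ q :=
  GRing.isLinear.Build R (Cn R 3) R _ (levi_covector q) (levi_covector_is_linear q).

Lemma normal_part_holomorphic_tangent q w : sqnorm q = 4 ->
  holomorphic_tangent (@boundary R) (Fmap q) w -> normal_part q w = 0.
Proof.
move=> q4; rewrite holomorphic_tangent_boundary // => -[a [b [-> ab]]].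
by rewrite normal_part_dF.
Qed.

(* Differentiate [normal_part] of a section along a curve in the boundary. *)
Lemma normal_part_derive_section q (Y : Cn R 3 -> Cn R 3) (a b c d : R[i]) : sqnorm q = 4 ->
  Re (a * conjc (ccoord q 0) + b * conjc (ccoord q 1)) = 0 ->
  local_section (@boundary R) (Fmap q) Y -> Y (Fmap q) = dF (ccoord q 0) c d ->
  normal_part q ('D_(dF (ccoord q 0) a b) Y (Fmap q)) =
    - (6 * a * ((2 * ccoord q 0 - 1) * c) * conjc (ccoord q 0) +
       c * conjc a + d * conjc b).
Proof.
move=> q4 ab [W [oW Wq sY Ytan]] Yq.
have [s [s0 ss s4 sa sb]] := sphere_curve q4 ab.
have sF := smooth_Fmap_comp (@openT R^o) ss.
pose g (t : R^o) := Fmap (s t).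
have cs j : cdifferentiable (fun t => ccoord (s t) j) (0 : R^o).
  exact: csmooth_differentiable (ss j) I.
have dg : differentiable g 0 by exact: smooth_on_differentiable sF I.
have g0 : g 0 = Fmap q by rewrite /g s0.
have Dg : 'D_(1 : R^o) g 0 = dF (ccoord q 0) a b.
  by rewrite derive_Fmap_comp // sa sb s0.
have dY : differentiable Y (g 0) by rewrite g0; exact: smooth_on_differentiable sY Wq.
pose y j (t : R^o) := ccoord (Y (g t)) j.
have cy j : cdifferentiable (y j) 0.
  exact: (cdifferentiable_comp dg (differentiable_ccoord _ dY)).
have Dy j : cD (1 : R^o) (y j) 0 = ccoord ('D_(dF (ccoord q 0) a b) Y (Fmap q)) j.
  have := @cD_comp R 3 _ g (fun p => ccoord (Y p) j) 0 1 dg (differentiable_ccoord _ dY).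
  by rewrite Dg g0 => ->; rewrite ccoord_derive // -g0.
pose u (t : R^o) := ccoord (s t) 0; pose v (t : R^o) := ccoord (s t) 1.
have nW : \forall t \near (0 : R^o), W (g t).
  have cg : {for (0 : R^o), continuous g} by exact: smooth_continuous sF I.
  by apply: (cg W); rewrite g0; exact: open_nbhs_nbhs.
(* The base point varies too: the coefficient 6u - 1 contributes the term in 6a, and the conjugates
   of u and v contribute the Hermitian terms. *)
have Phi0 : \forall t \near (0 : R^o),
    ((6 * u t - 1) * y 0 t - 4 * y 2 t) * conjc (u t) + y 1 t * conjc (v t) = 0.
  apply: filterS nW => t Wt.
  apply: (normal_part_holomorphic_tangent (s4 t)); apply: Ytan => //.
  by exists (s t) => //; rewrite sphereSE; exact: s4.
have := near_eq_cD (1 : R^o) Phi0.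
have [cu cv] := (cs 0, cs 1).
have k6 := cdifferentiable_cst (6 : R[i]) (0 : R^o).
have k4 := cdifferentiable_cst (4 : R[i]) (0 : R^o).
have k1 := cdifferentiable_cst (1 : R[i]) (0 : R^o).
have c6u := cdifferentiableM k6 cu.
have c6u1 := cdifferentiableB c6u k1.
have cA := cdifferentiableM c6u1 (cy 0).
have cB := cdifferentiableM k4 (cy 2).
have cC := cdifferentiableB cA cB.
have cu' := cdifferentiable_conj cu; have cv' := cdifferentiable_conj cv.
rewrite cD_cst (cDD _ (cdifferentiableM cC cu') (cdifferentiableM (cy 1) cv')).
rewrite (cDM _ cC cu') (cDM _ (cy 1) cv') (cDB _ cA cB) (cDM _ c6u1 (cy 0)).
rewrite (cDM _ k4 (cy 2)) (cDB _ c6u k1) (cDM _ k6 cu) !cD_cst.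
rewrite (cD_conj _ cu) (cD_conj _ cv) !Dy.
have y0 j : y j 0 = ccoord (dF (ccoord q 0) c d) j by rewrite /y g0 Yq.
rewrite s0 !y0 /normal_part.
set D := derive _ _ _; rewrite /dF !ptE sa sb => eq0.
apply/eqP; rewrite -addr_eq0; apply/eqP; rewrite -[RHS]eq0.
set A := conjc a; set B := conjc b; set U := conjc (ccoord q 0); set V := conjc (ccoord q 1).
have -> : c = (6 * ccoord q 0 - 1) * ((2 * ccoord q 0 - 1) * c) -
  4 * ((3 * ccoord q 0 ^+ 2 - 2 * ccoord q 0) * c) by rewrite bezout_F.
ring.
Qed.

(** The complex orthogonal of a point (u, v) of the sphere is spanned by (- conj v, conj u), which
    depends smoothly on the point. A constant multiple of it, written through the local inverse,
    extends the given vector. *)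
Lemma local_section_exists q a b : sqnorm q = 4 ->
  a * conjc (ccoord q 0) + b * conjc (ccoord q 1) = 0 ->
  exists2 X, local_section (@boundary R) (Fmap q) X & X (Fmap q) = dF (ccoord q 0) a b.
Proof.
move=> q4 /(orthogonal_sphere q4)[c [-> ->]].
have Sq : sphereS q by rewrite sphereSE.
have [W [U [oW Wq sU UK]]] := local_inverse Sq.
exists (fun p => dF (U p) (c * - conjc (ccoord p 1)) (c * conjc (U p))); last first.
  by rewrite UK // Fmap1.
exists W; split=> //.
  have sy := @csmooth_ccoord R 3 W 1.
  apply: smooth_vec => //; apply: ord3P; rewrite /dF;
    under [X in csmooth _ X]eq_fun do rewrite ptE; by csmooth_tac.
move=> _ [q' Sq' <-] Wq'; have q'4 : sqnorm q' = 4 by move: Sq'; rewrite sphereSE.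
rewrite holomorphic_tangent_boundary // UK // Fmap1.
exists (c * - conjc (ccoord q' 1)), (c * conjc (ccoord q' 0)); split=> //; ring.
Qed.

Lemma strongly_pseudoconvex_boundary : strongly_pseudoconvex (@boundary R).
Proof.
move=> p [q Sq <-]; have q4 : sqnorm q = 4 by move: Sq; rewrite sphereSE.
exists (levi_covector q); split.
  move=> v vtan; rewrite /= /levi_covector normal_part_holomorphic_tangent //.
  by rewrite Im0 oppr0.
move=> v; rewrite holomorphic_tangent_boundary // => -[a [b [-> ab]]] v0; split.
  have [X sX Xq] := local_section_exists q4 ab.
  by exists (levi_covector q (lie_bracket X (@mulI R 3 \o X) (Fmap q))), X, X.
move=> c [X [Y [sX sY Xq Yq <-]]].
have dY : differentiable Y (Fmap q).
  by have [W [_ Wq sY' _]] := sY; exact: smooth_on_differentiable sY' Wq.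
have ab1 : Re (a * conjc (ccoord q 0) + b * conjc (ccoord q 1)) = 0 by rewrite ab.
have abi : Re ('i%C * a * conjc (ccoord q 0) + 'i%C * b * conjc (ccoord q 1)) = 0.
  by rewrite -!mulrA -mulrDr ab mulr0.
have NY := normal_part_derive_section q4 ab1 sY Yq.
have NX := normal_part_derive_section q4 abi sX Xq.
have DJ k : 'D_k (@mulI R 3 \o Y) (Fmap q) = mulI ('D_k Y (Fmap q)).
  have dJY : differentiable (@mulI R 3 \o Y) (Fmap q).
    apply: differentiable_vec => j.
    under [X in cdifferentiable X]eq_fun do rewrite /= ccoord_mulI.
    apply: cdifferentiableM; first exact: cdifferentiable_cst.
    exact: differentiable_ccoord.
  apply: ccoordP => j; rewrite [LHS]ccoord_derive // ccoord_mulI [X in _ * X]ccoord_derive //.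
  under [X in cD _ X]eq_fun do rewrite /= ccoord_mulI.
  rewrite (cDM _ (cdifferentiable_cst 'i%C (Fmap q)) (differentiable_ccoord j dY)).
  by rewrite cD_cst mul0r add0r.
have NJ w : normal_part q (mulI w) = 'i%C * normal_part q w.
  by rewrite /normal_part !ccoord_mulI; ring.
have NB w w' : normal_part q (w - w') = normal_part q w - normal_part q w'.
  by rewrite /normal_part !ccoordD !ccoordN; ring.
have JYq : (@mulI R 3 \o Y) (Fmap q) = dF (ccoord q 0) ('i%C * a) ('i%C * b).
  by rewrite -mulI_dF -Yq.
rewrite -[X in 0 < X]/(- Im (normal_part q (lie_bracket X (@mulI R 3 \o Y) (Fmap q)))).
rewrite /lie_bracket JYq Xq DJ NB NJ NY NX.
have : 0 < sqn a + sqn b.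
  rewrite lt_neqAle addr_ge0 ?sqn_ge0 // andbT eq_sym paddr_eq0 ?sqn_ge0 // !sqn_eq0.
  by apply: contraNN v0 => /andP[/eqP-> /eqP->]; rewrite dF00.
(* The terms in 6a are complex bilinear, hence equal in i N(D_v Y) and N(D_iv X), and cancel. The
   Hermitian terms acquire opposite factors of i and add up. *)
rewrite (_ : _ - _ = - 'i%C * 2 * (a * conjc a + b * conjc b)); last first.
  rewrite !rmorphM /= (_ : conjc 'i%C = - 'i%C); last first.
    by apply: complex_ext; rewrite ?ReImE /= ?oppr0.
  ring.
by rewrite -!sqnE -rmorphD !ReImE /= => ?; lra.
Qed.

End LeviForm.

(** * Scalar holomorphic functions *)

Section HolomorphicFunctions.
Variables (R : realType) (n : nat).
Implicit Types (f g : Cn R n -> R[i]) (p v : Cn R n).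

Definition cholomorphic f p := cdifferentiable f p /\
  forall v, cD (mulI v) f p = 'i%C * cD v f p.

Lemma cholomorphic_cst (c : R[i]) p : cholomorphic (fun _ => c) p.
Proof.
by split=> [|v]; [exact: cdifferentiable_cst|rewrite !cD_cst mulr0].
Qed.

Lemma cholomorphic_ccoord j p : cholomorphic (fun p => ccoord p j) p.
Proof.
split=> [|v]; first exact: csmooth_differentiable (csmooth_ccoord setT j) I.
by rewrite !cD_ccoord ccoord_mulI.
Qed.

Lemma cholomorphicB f g p : cholomorphic f p -> cholomorphic g p ->
  cholomorphic (fun p => f p - g p) p.
Proof.
move=> [df Jf] [dg Jg]; split=> [|v]; first exact: cdifferentiableB.
by rewrite (cDB _ df dg) (cDB _ df dg) Jf Jg mulrBr.
Qed.

Lemma cholomorphicM f g p : cholomorphic f p -> cholomorphic g p ->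
  cholomorphic (fun p => f p * g p) p.
Proof.
move=> [df Jf] [dg Jg]; split=> [|v]; first exact: cdifferentiableM.
by rewrite (cDM _ df dg) (cDM _ df dg) Jf Jg; ring.
Qed.

Lemma cholomorphicX f k p : cholomorphic f p -> cholomorphic (fun p => f p ^+ k) p.
Proof.
move=> hf; elim: k => [|k IH].
  by under [X in cholomorphic X]eq_fun do rewrite expr0; exact: cholomorphic_cst.
by under [X in cholomorphic X]eq_fun do rewrite exprS; exact: cholomorphicM.
Qed.

Lemma holomorphic_on1 (D : set (Cn R n)) f :
  (forall p, D p -> cholomorphic f p) ->
  holomorphic_on D (fun p => cvec 1 [:: f p] : Cn R 1).
Proof.
move=> hf; apply: holomorphic_vec => p Dp j; rewrite ord1.
by under [X in cdifferentiable X]eq_fun do rewrite ccoord_cvec;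
   under [X in _ /\ X]eq_forall do under eq_fun do rewrite ccoord_cvec;
   exact: hf.
Qed.

End HolomorphicFunctions.

(** * The variety bounded by the image of the sphere *)

Section Sheets.
Variable R : realType.
Implicit Types (q : Cn R 2) (p : Cn R 3).

(** Implicit differentiation: s^2 = 1 + 4x gives 2 s ds = 4 dx with s nonzero, so ds inherits
    complex linearity from dx. *)
Lemma cholomorphic_Uroot e p : root_domain p -> cholomorphic (@Uroot R e) p.
Proof.
move=> Dp; pose h p : R[i] := 1 + 4 * ccoord p 0; pose s p := sqrtc (h p).
have oD := @open_root_domain R.
have ss : csmooth (@root_domain R) s.
  by apply: csmooth_sqrt => //; rewrite /h; have := @csmooth_ccoord R 3 (@root_domain R) 0;
    move=> ?; csmooth_tac.
have cs := csmooth_differentiable ss Dp.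
have s0 : s p != 0.
  by apply/eqP => s0; have := Re_sqrtc_gt0 Dp; rewrite -/(h p) -/(s p) s0 ltxx.
have [cx Jx] := cholomorphic_ccoord 0 p.
have c4 := cdifferentiable_cst (4 : R[i]) p.
have c1 := cdifferentiable_cst (1 : R[i]) p.
have Ds v : 2 * s p * cD v s p = 4 * ccoord v 0.
  have hs : (fun p => s p * s p) = h by apply/funext => y; rewrite -expr2 sqr_sqrtc.
  have := congr1 (fun f => cD v f p) hs; rewrite /= (cDM _ cs cs).
  rewrite [RHS](cDD _ c1 (cdifferentiableM c4 cx)) (cDM _ c4 cx) !cD_cst cD_ccoord.
  by rewrite mul0r !add0r => <-; ring.
have Js : cholomorphic s p.
  split=> // v; have n0 : 2 * s p != 0 by rewrite mulf_neq0.
  by apply: (mulfI n0); rewrite Ds mulrCA Ds ccoord_mulI; ring.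
have eE : Uroot e = fun p => (1 - (- e) * s p) * (2^-1).
  by apply/funext => y; rewrite /Uroot mulNr opprK.
rewrite eE; apply: cholomorphicM (cholomorphic_cst _ _).
apply: cholomorphicB; first exact: cholomorphic_cst.
by apply: cholomorphicM => //; exact: cholomorphic_cst.
Qed.

(** Where x is nonzero, dividing the equation by x^2 gives u (u - 1) = x for u = z / x. Where x = 0
    it forces z = 0, and u = 0 is a preimage. *)
Lemma range_Fmap : range (@Fmap R) =
  [set p | ccoord p 2 ^+ 2 - ccoord p 2 * ccoord p 0 - ccoord p 0 ^+ 3 = 0].
Proof.
apply/seteqP; split=> p /=.
  by move=> [q _ <-]; rewrite Fmap0 Fmap2; ring.
move=> pE; have [x0|x0] := eqVneq (ccoord p 0) 0.
  have z0 : ccoord p 2 = 0.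
    move: pE; rewrite x0 mulr0 expr0n /= !subr0 => /eqP.
    by rewrite sqrf_eq0 => /eqP.
  exists (pt2 0 (ccoord p 1)) => //.
  by rewrite FmapE [RHS]pt3P x0 z0 mul0r expr0n mul0r.
exists (pt2 (ccoord p 2 / ccoord p 0) (ccoord p 1)) => //.
rewrite FmapE [RHS]pt3P; set x := ccoord p 0 in pE x0 *; set z := ccoord p 2 in pE *.
have z2 : z ^+ 2 = z * x + x ^+ 3 by apply/eqP; rewrite -subr_eq0 -pE; apply/eqP; ring.
have e1 : z / x * (z / x - 1) = x.
  have -> : z / x * (z / x - 1) = (z ^+ 2 - z * x) / x ^+ 2 by field.
  by rewrite z2; field.
congr pt3 => //.
by rewrite expr2 -mulrA e1 divfK.
Qed.

Lemma Fmap_inj_neq0 q q' : ccoord (Fmap q) 0 != 0 -> Fmap q = Fmap q' -> q = q'.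
Proof.
by move=> x0 e; rewrite -(inv_withK (UquotK x0)) e inv_withK // UquotK // -e.
Qed.

Lemma closed_ge4 : closed [set q : Cn R 2 | 4 <= sqnorm q].
Proof.
rewrite (_ : [set q | _] = [set q | - sqnorm q <= -4]).
  by apply: closed_le_fun => q; apply: cvgN; exact: continuous_sqnorm.
by apply/seteqP; split=> q /=; rewrite lerN2.
Qed.

Lemma compact_image_Fmap (K : set (Cn R 2)) (M : R) :
  closed K -> (forall q, K q -> sqnorm q <= M) -> compact (@Fmap R @` K).
Proof.
move=> cK KM; apply: continuous_compact.
  by apply: continuous_subspaceT => q; exact: continuous_Fmap.
apply: (@subclosed_compact _ K [set q | sqnorm q <= M]) => //; exact: compact_sqnorm_le.
Qed.

Lemma compact_closed_Cn n (K : set (Cn R n)) : compact K -> closed K.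
Proof. by apply: compact_closed; exact: norm_hausdorff. Qed.

Lemma closed_boundary : closed (@boundary R).
Proof.
apply: compact_closed_Cn; apply: (compact_image_Fmap (M := 4)).
  rewrite sphereSE (_ : mkset _ = [set q | sqnorm q <= 4] `&` [set q | 4 <= sqnorm q]).
    by apply: closedI; [apply: closed_le_fun; exact: continuous_sqnorm|exact: closed_ge4].
  apply/seteqP; split=> q /=; first by move=> ->.
  by move=> [le ge]; apply/eqP; rewrite eq_le le ge.
by move=> q; rewrite sphereSE /= => ->.
Qed.

Definition variety : set (Cn R 3) := @Fmap R @` @ballB R.

Lemma compact_variety : compact variety.
Proof.
rewrite /variety; apply: (@compact_image_Fmap _ 4); first exact: closed_ballB.
by rewrite ballBE.
Qed.

Lemma boundary_sub_variety : @boundary R `<=` variety.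
Proof. by move=> p [q Sq <-]; exists q => //; move: Sq; rewrite sphereSE ballBE /= => ->. Qed.

Lemma interior_preimage q : ballB q -> ~ boundary (Fmap q) -> sqnorm q < 4.
Proof.
rewrite ballBE /= => qB nM; rewrite lt_neqAle qB andbT; apply/eqP => q4.
by apply: nM; exists q => //; rewrite sphereSE.
Qed.

(* [Fmap] is proper. *)
Lemma open_fibre p : (forall q, Fmap q = p -> sqnorm q < 4) ->
  exists O : set (Cn R 3), [/\ open O, O p & forall q, O (Fmap q) -> sqnorm q < 4].
Proof.
move=> pf.
pose a := sqn (ccoord p 0) + 1; pose b := sqn (ccoord p 1) + 1.
(* [K] catches every point outside the open ball with |x|^2 < a and |v|^2 < b: either |u|^2 < 4, or
   |u| >= 2, whence |u - 1| >= 1 and |u|^2 <= |x|^2 < a. *)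
pose K := [set q : Cn R 2 | sqnorm q <= 4 + a + b] `&` [set q | 4 <= sqnorm q].
have cK : compact (@Fmap R @` K).
  apply: (@compact_image_Fmap _ (4 + a + b)); last by move=> q [].
  by apply: closedI; [apply: closed_le_fun; exact: continuous_sqnorm|exact: closed_ge4].
have oK : open (~` (@Fmap R @` K)) by apply: closed_openC; exact: compact_closed_Cn.
exists [set p' | ((~` (@Fmap R @` K)) p' /\ sqn (ccoord p' 0) < a) /\ sqn (ccoord p' 1) < b].
split.
- by do 2!apply: open_coord_lt.
- split; last by rewrite /b ltrDl.
  split; last by rewrite /a ltrDl.
  by move=> [q [_ /= q4] /pf]; rewrite ltNge q4.
- move=> q [[nK]]; rewrite Fmap0 Fmap1 sqnM => xa yb.
  rewrite ltNge; apply/negP => q4; apply: nK; exists q => //; split=> //=.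
  rewrite /sqnorm; have [u4|u4] := ltrP (sqn (ccoord q 0)) 4.
    by have := sqn_ge0 (ccoord p 0); rewrite /a; lra.
  suff : 1 <= sqn (ccoord q 0 - 1).
    move=> s1; have := ler_peMr (sqn_ge0 (ccoord q 0)) s1; lra.
  move: u4; rewrite /sqn !ReImE; set r := Re _; set s := Im _ => u4.
  have : 2 * r <= r ^+ 2 + s ^+ 2.
    by rewrite leNgt; apply/negP => lt; have := sqr_ge0 s; nra.
  lra.
Qed.

End Sheets.

(** * Charts and local equations of the image of the ball, and the line of double points *)

Section Varieties.
Variable R : realType.

Lemma sqn0 : sqn (0 : R[i]) = 0.
Proof. by rewrite /sqn !ReImE expr0n addr0. Qed.

Lemma sqn1 : sqn (1 : R[i]) = 1.
Proof. by rewrite /sqn !ReImE expr0n expr1n addr0. Qed.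

Implicit Types (q : Cn R 2) (p : Cn R 3).

Local Notation V := (@variety R `\` @boundary R).

Lemma open_not_boundary : open (~` @boundary R).
Proof. by apply: closed_openC; exact: closed_boundary. Qed.

(** The chart is [Fmap] itself, on the part of the open ball mapped into [D]. The function [U] only
    witnesses injectivity and the continuity of the inverse. *)
Lemma chart_Fmap (D : set (Cn R 3)) (U : Cn R 3 -> R[i]) p :
  open D -> D p -> csmooth D U -> D `<=` ~` @boundary R ->
  (forall q, ballB q -> D (Fmap q) -> U (Fmap q) = ccoord q 0) ->
  complex_manifold_at 2 V p.
Proof.
move=> oD Dp sU DM UK.
pose W := [set q | (@Fmap R @^-1` D) q /\ sqnorm q < 4].
have WB q : W q -> ballB q by move=> [_ /ltW]; rewrite ballBE.
exists D, W, (@Fmap R); split.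
- by [].
- split.
    apply: open_lt_fun => [|q _|q _]; last exact: cvg_cst.
      by apply: open_comp => // q _; exact: continuous_Fmap.
    exact: continuous_sqnorm.
  by move=> q _; exact: holomorphic_Fmap.
- move=> q _ v v'; rewrite !diff_Fmap => /dF_inj[v0 v1].
  by apply: ccoordP; apply: ord2P.
- apply: topological_embedding_local_inverse => [q _|q [Dq q4]].
    exact: continuous_Fmap.
  exists (inv_with U); first exact: smooth_continuous (smooth_inv_with oD sU) Dq.
  have : \forall p' \near Fmap q, D p' by exact: open_nbhs_nbhs.
  apply: filterS => p' Dp' q' Wq' q'p'; rewrite -q'p' inv_withK // UK ?q'p' //.
  exact: WB.
- apply/seteqP; split=> p' /=.
    move=> [q [Dq q4] <-]; split=> //; split; last exact: DM.
    by exists q => //; apply: WB.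
  move=> [[[q qB <-] nM] Dq]; exists q => //; split=> //.
  exact: interior_preimage.
Qed.

Lemma chart_regular p : ~ @boundary R p -> ccoord p 0 != 0 -> complex_manifold_at 2 V p.
Proof.
move=> nM x0.
have oX := @open_coord_neq0 R 3 0.
pose D := [set p : Cn R 3 | ccoord p 0 != 0] `&` ~` @boundary R.
apply: (@chart_Fmap D (@Uquot R)) => //.
- by apply: openI => //; exact: open_not_boundary.
- by apply: csmooth_subset (@csmooth_Uquot R) => p' [].
- by move=> p' [].
- by move=> q _ [x1 _]; exact: UquotK.
Qed.

(* Near [(0, t, 0)] with [3 < |t|^2] only the sheet [u = 0] of [Fmap] meets the
   image of the ball. *)
Lemma branch_nbhd (t : R[i]) : 3 < sqn t < 4 ->
  exists D : set (Cn R 3), [/\ open D, D (pt3 0 t 0), D `<=` @root_domain R, D `<=` ~` @boundary R &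
    (forall p, D p -> sqnorm (inv_with (Uroot (- 1)) p) < 4) /\
    (forall q, ballB q -> D (Fmap q) -> Uroot (- 1) (Fmap q) = ccoord q 0)].
Proof.
move=> /andP[t3 t4].
have m1 : (- 1 : R[i]) ^+ 2 = 1 by rewrite sqrrN expr1n.
have F0t q : Fmap q = pt3 0 t 0 -> ccoord q 1 = t /\ (ccoord q 0 = 0 \/ ccoord q 0 = 1).
  move=> Fq; split; first by rewrite -Fmap1 Fq ptE.
  by have /eqP := congr1 (fun p => ccoord p 0) Fq; rewrite ptE Fmap0_eq0 =>
    /orP[/eqP|/eqP]; [left|right].
(* The half Re u >= 1/2 of the ball has a compact image, which misses (0, t, 0) because (1, t) lies
   outside the ball. Off this image only the root with sign -1 can occur. *)
pose K := [set q : Cn R 2 | sqnorm q <= 4] `&` [set q | - Re (ccoord q 0) <= - (1 / 2)].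
have cK : compact (@Fmap R @` K).
  apply: (@compact_image_Fmap _ _ 4); last by move=> q [].
  apply: closedI; first by apply: closed_le_fun; exact: continuous_sqnorm.
  by apply: closed_le_fun => q; apply: cvgN; exact: continuous_re_coord.
have oK : open (~` (@Fmap R @` K)) by apply: closed_openC; exact: compact_closed_Cn.
have oD := @open_root_domain R.
have sI := smooth_inv_with oD (csmooth_Uroot (- 1)).
(* Over [D0] the candidate preimage stays in the open ball, so every point of the sheet there is in
   the image of the ball. *)
pose D0 := [set p | @root_domain R p /\ sqnorm (inv_with (Uroot (- 1)) p) < 4].
have oD0 : open D0.
  apply: open_lt_fun => // p Dp; last exact: cvg_cst.
  apply: (@continuous_comp _ _ _ (inv_with (Uroot (- 1))) (@sqnorm R)).
    exact: smooth_continuous sI Dp.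
  exact: continuous_sqnorm.
exists ((D0 `&` ~` @boundary R) `&` ~` (@Fmap R @` K)); split.
- by apply: openI => //; apply: openI => //; exact: open_not_boundary.
- split; first split; first split.
  + by change (0 < Re (1 + 4 * ccoord (pt3 0 t 0) 0)); rewrite ptE mulr0 addr0 Re1.
  + have -> : pt3 0 t 0 = Fmap (pt2 0 t) :> Cn R 3 by rewrite FmapE mul0r expr0n mul0r.
    rewrite inv_withK; first by rewrite sqnorm_pt2 sqn0 add0r.
    by apply: UrootK => //; rewrite ptE mulr0 sub0r mulrNN mulr1 Re1.
  + move=> [q Sq /F0t[qt]]; move: Sq; rewrite sphereSE /= /sqnorm qt => S4 [] u0;
      move: S4; rewrite u0 ?sqn0 ?sqn1 => ?; lra.
  + move=> [q [/= q4 qr] /F0t[qt]].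
    have {}qr : 1 / 2 <= Re (ccoord q 0) by rewrite -lerN2.
    by move=> [] u0; move: qr q4; rewrite /sqnorm u0 qt ?sqn0 ?sqn1 ?ReImE => ? ?; lra.
- by move=> p [[[]]].
- by move=> p [[]].
- split; first by move=> p [[[]]].
  move=> q qB [[_ _] nK]; apply: UrootK => //.
  rewrite !ReImE.
  have : ~ (1 / 2 <= Re (ccoord q 0)).
    by move=> r12; apply: nK; exists q => //; split; [move: qB; rewrite ballBE|rewrite /= lerN2].
  by move=> /negP; rewrite -ltNge => ?; lra.
Qed.

(** The value |t|^2 = 3 is excluded because then (1, t) is on the sphere, so that (0, t, 0) is a
    boundary point. *)
Lemma variety_axis p : V p -> ccoord p 0 = 0 ->
  p = pt3 0 (ccoord p 1) 0 /\ (sqn (ccoord p 1) < 3 \/ 3 < sqn (ccoord p 1) < 4).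
Proof.
move=> [[q qB qp] nM] x0; have qn := interior_preimage qB; rewrite qp in qn.
have q4 := qn nM; set t := ccoord p 1.
have qt : ccoord q 1 = t by rewrite -Fmap1 qp.
have u01 : ccoord q 0 = 0 \/ ccoord q 0 = 1.
  have /eqP := x0; rewrite -qp Fmap0_eq0 => /orP[/eqP|/eqP]; [by left|by right].
have pE : p = pt3 0 t 0.
  rewrite -qp [q]pt2P FmapE qt; case: u01 => ->; first by rewrite mul0r expr0n mul0r.
  by rewrite subrr !mulr0.
split=> //.
have t4 : sqn t < 4 by move: q4; rewrite /sqnorm qt; have := sqn_ge0 (ccoord q 0); lra.
have [//|t3|t3] := ltgtP (sqn t) 3; [by left|by right; rewrite t4|].
case: nM; exists (pt2 1 t); first by rewrite sphereSE /= sqnorm_pt2 t3 sqn1; lra.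
by rewrite FmapE pE subrr !mulr0.
Qed.

Lemma chart_branch (t : R[i]) : 3 < sqn t < 4 -> complex_manifold_at 2 V (pt3 0 t 0).
Proof.
move=> /branch_nbhd[D [oD Dp Dr DM [_ UK]]].
apply: (@chart_Fmap D (Uroot (- 1))) => //.
by apply: csmooth_subset (csmooth_Uroot _).
Qed.

Definition regular_ball := [set q : Cn R 2 | sqnorm q < 4 /\ ccoord (Fmap q) 0 != 0].

Lemma regular_ball_sub q : regular_ball q -> V (Fmap q).
Proof.
move=> [q4 x0]; split; first by exists q => //; rewrite ballBE /= ltW.
move=> [q' Sq' q'q]; have q'E : q = q' by exact: Fmap_inj_neq0.
by move: Sq' q4; rewrite -q'E sphereSE /= => ->; rewrite ltxx.
Qed.

(* The segment towards [(i/2, 0)] or [(-i/2, 0)] avoids real values of [u]. *)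
Lemma regular_ball_dense q : ballB q -> closure (@Fmap R @` regular_ball) (Fmap q).
Proof.
rewrite ballBE /= => qB B BF.
have [e e2 eIm] : exists2 e : R, e ^+ 2 = 1 & 0 <= e * Im (ccoord q 0).
  have [ge0|lt0] := lerP 0 (Im (ccoord q 0)).
    by exists 1; [rewrite expr1n|rewrite mul1r].
  by exists (-1); [rewrite sqrrN expr1n|lra].
pose c : Cn R 2 := pt2 (Complex 0 (e / 2)) 0.
pose s (t : R) := (1 - t) *: q + t *: c.
have s0 : s 0 = q by rewrite /s subr0 scale1r scale0r addr0.
have cs : s @ (0 : R) --> q.
  rewrite -[X in _ --> X]s0; apply: cvgD; apply: cvgZr_tmp; last exact: cvg_id.
  by apply: cvgB; [exact: cvg_cst|exact: cvg_id].
have nB : \forall t \near (0 : R), B (Fmap (s t)).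
  by apply: (cs [set q' | B (Fmap q')]); exact: continuous_Fmap.
move: nB => /nbhs_ballP[d /= d0 dB].
pose t := Num.min (d / 2) (1 / 2).
have t0 : 0 < t by rewrite lt_min !divr_gt0.
have td : t < d by rewrite gt_min ltr_pdivrMr // ltr_pMr // ltr1n.
have t1 : t <= 1 / 2 by rewrite ge_min lexx orbT.
clearbody t.
exists (Fmap (s t)); split; last first.
  by apply: dB; rewrite /ball /= sub0r normrN gtr0_norm.
exists (s t) => //; split.
  have nc : sqnorm c = 1 / 4.
    by rewrite sqnorm_pt2 sqn0 /sqn /= expr_div_n e2; field.
  (* Convexity of the squared norm in exact form; since [c] has squared norm 1/4, the value is below
     4 for t > 0. *)
  have -> : sqnorm (s t) = (1 - t) * sqnorm q + t * sqnorm c - t * (1 - t) * sqnorm (q - c).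
    by rewrite /s /sqnorm /sqn !ccoordD !ccoordN !ccoordZ !ReImE /=; ring.
  have nqc : 0 <= sqnorm (q - c) by rewrite addr_ge0 // sqn_ge0.
  have t1' : 0 <= 1 - t by lra.
  have : 0 <= t * (1 - t) * sqnorm (q - c) by rewrite !mulr_ge0 // ltW.
  have : (1 - t) * sqnorm q <= (1 - t) * 4 by apply: ler_wpM2l.
  rewrite nc; lra.
have Ims : 0 < e * Im (ccoord (s t) 0).
  have -> : e * Im (ccoord (s t) 0) = (1 - t) * (e * Im (ccoord q 0)) + t * e ^+ 2 / 2.
    by rewrite /s ccoordD !ccoordZ ptE !ReImE /=; field.
  by rewrite e2; apply: ltr_wpDl; [apply: mulr_ge0 => //; lra|lra].
by rewrite Fmap0_eq0; apply/negP => /orP[] /eqP s01; move: Ims; rewrite s01 ?Im0 ?Im1 mulr0 ltxx.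
Qed.

Lemma closure_variety : closure V = @variety R.
Proof.
apply/seteqP; split.
  have cV : closed (@variety R) by apply: compact_closed_Cn; exact: compact_variety.
  by rewrite [X in _ `<=` X](closure_id _).1 //; apply: closure_subset => p [].
move=> _ [q qB <-]; apply: closure_subset (regular_ball_dense qB).
by move=> _ [q' rq' <-]; exact: regular_ball_sub.
Qed.

Lemma regular_dense : V `<=` closure [set p | V p /\ complex_manifold_at 2 V p].
Proof.
move=> _ [[q qB <-] _]; apply: closure_subset (regular_ball_dense qB).
move=> _ [q' rq' <-]; have Vq' := regular_ball_sub rq'; split=> //.
by apply: chart_regular; [case: Vq'|case: rq'].
Qed.

Lemma cvec1_eq0 (a : R[i]) : (cvec 1 [:: a] = 0 :> Cn R 1) <-> a = 0.
Proof.
split=> [a0|->]; first by rewrite -[LHS](ccoord_cvec (n := 1) [:: a] 0) a0 ccoord0.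
by apply: ccoordP => j; rewrite ccoord_cvec ord1 ccoord0.
Qed.

Lemma analytic_variety : analytic_subset (~` @boundary R) V.
Proof.
split=> [p []//|p /= nMp].
have [[q qB qp]|nVp] := pselect (@variety R p); last first.
  (* Off the image of the ball the local equation is 1 = 0. *)
  exists (~` @variety R), 1%N, (fun p => cvec 1 [:: 1] : Cn R 1); split=> //.
  - by apply: closed_openC; apply: compact_closed_Cn; exact: compact_variety.
  - by apply: holomorphic_on1 => p' _; exact: cholomorphic_cst.
  - apply/seteqP; split=> p' /=; first by move=> [[]].
    by move=> [_ /cvec1_eq0 /eqP]; rewrite oner_eq0.
have nM q' : Fmap q' = p -> sqnorm q' != 4.
  by move=> q'p; apply/eqP => q'4; apply: nMp; exists q' => //; rewrite sphereSE.
have [fib|] := pselect (forall q, Fmap q = p -> sqnorm q < 4).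
  have [D [oD Dp D4]] := open_fibre fib.
  exists D, 1%N, (fun p => cvec 1
    [:: ccoord p 2 ^+ 2 - ccoord p 2 * ccoord p 0 - ccoord p 0 ^+ 3] : Cn R 1).
  split=> //.
    apply: holomorphic_on1 => p' _.
    have hc j := cholomorphic_ccoord j p'.
    apply: cholomorphicB (cholomorphicX 3 (hc 0)).
    exact: cholomorphicB (cholomorphicX 2 (hc 2)) (cholomorphicM (hc 2) (hc 0)).
  apply/seteqP; split=> p' /=.
    move=> [[[q' _ <-] _] Dq']; split=> //; apply/cvec1_eq0.
    by rewrite Fmap0 Fmap2; ring.
  move=> [Dp' /cvec1_eq0 p'0].
  have [q' _ q'p] : range (@Fmap R) p' by rewrite range_Fmap.
  have q'4 : sqnorm q' < 4 by apply: D4; rewrite q'p.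
  split=> //; split; first by exists q' => //; rewrite ballBE /= ltW.
  move=> [q'' Sq'' q''p]; have : sqnorm q'' < 4 by apply: D4; rewrite q''p.
  by move: Sq''; rewrite sphereSE /= => ->; rewrite ltxx.
(* The preimage [q2] outside the open ball differs from the interior preimage [q], so [p] is a
   double point (0, t, 0). Moreover |t|^2 < 3 is impossible, since both preimages would then be
   interior. *)
move=> /existsNP[q2 /not_implyP[q2p /negP]]; rewrite -leNgt => q2ge.
have Vp : V p by split=> //; exists q.
have q4 : sqnorm q < 4 by apply: interior_preimage => //; rewrite qp.
have x0 : ccoord p 0 = 0.
  apply/eqP/negPn/negP => x0; have qq2 : q = q2.
    by apply: Fmap_inj_neq0; rewrite qp.
  by move: q4; rewrite qq2 ltNge q2ge.
have [pE t34] := variety_axis Vp x0; set t := ccoord p 1 in pE t34.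
have t3 : 3 < sqn t < 4.
  case: t34 => // t3; have := nM _ q2p; move: q2ge.
  have q2t : ccoord q2 1 = t by rewrite -Fmap1 q2p.
  rewrite /sqnorm q2t; have /eqP := x0; rewrite -q2p Fmap0_eq0 => /orP[/eqP|/eqP] ->;
    rewrite ?sqn0 ?sqn1 => q2ge _; clear -t3 q2ge; exfalso; lra.
have [D [oD Dp Dr DM [D4 UK]]] := branch_nbhd t3.
(* The single sheet is the graph z = x u, with u the holomorphic root of u (u - 1) = x. *)
exists D, 1%N, (fun p => cvec 1 [:: ccoord p 2 - ccoord p 0 * Uroot (- 1) p] : Cn R 1).
split=> //; first by rewrite pE.
  apply: holomorphic_on1 => p' Dp'.
  apply: cholomorphicB; first exact: cholomorphic_ccoord.
  apply: cholomorphicM; first exact: cholomorphic_ccoord.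
  by apply: cholomorphic_Uroot; exact: Dr.
apply/seteqP; split=> p' /=.
  move=> [[[q' q'B <-] _] Dq']; split=> //; apply/cvec1_eq0.
  by rewrite UK // Fmap0 Fmap2; ring.
move=> [Dp' /cvec1_eq0 /eqP]; rewrite subr_eq0 => /eqP p'2.
split=> //; split; last exact: DM.
exists (inv_with (Uroot (- 1)) p'); first by rewrite ballBE /= ltW // D4.
have m1 : (- 1 : R[i]) ^+ 2 = 1 by rewrite sqrrN expr1n.
rewrite /inv_with FmapE [RHS]pt3P p'2 -(UrootKP p' m1); congr pt3; ring.
Qed.

Lemma bounds_variety : bounds 2 (@boundary R) (@variety R).
Proof.
split.
- exact: compact_variety.
- exact: boundary_sub_variety.
- by split; [exact: analytic_variety|exact: regular_dense].
- exact: closure_variety.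
Qed.

Definition axis : set (Cn R 3) := [set pt3 0 t 0 | t in [set: R[i]]].

Lemma axisP p : axis p <-> ccoord p 0 = 0 /\ ccoord p 2 = 0.
Proof.
split=> [[t _ <-]|[p0 p2]]; first by rewrite !ptE.
by exists (ccoord p 1) => //; rewrite [RHS]pt3P p0 p2.
Qed.

Lemma axis_manifold p : axis p -> complex_manifold_at 1 axis p.
Proof.
move=> ap; pose phi (w : Cn R 1) : Cn R 3 := pt3 0 (ccoord w 0) 0.
have sphi : smooth_on setT phi.
  have oT := @openT (Cn R 1); apply: smooth_vec => //; apply: ord3P;
    by under [X in csmooth _ X]eq_fun do rewrite ptE; csmooth_tac.
pose g p : Cn R 1 := cvec 1 [:: ccoord p 1].
have sg : smooth_on setT g.
  have oT := @openT (Cn R 3); apply: smooth_vec => // j; rewrite ord1.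
  by under [X in csmooth _ X]eq_fun do rewrite ccoord_cvec; csmooth_tac.
have dphi w : differentiable phi w by exact: smooth_on_differentiable sphi I.
have phiK w : g (phi w) = w.
  by apply: ccoordP => j; rewrite ccoord_cvec ptE !ord1.
exists setT, setT, phi; split.
- by split=> //; exact: openT.
- split; first exact: openT.
  move=> w _; have hc (c : R[i]) := cholomorphic_cst c w.
  apply: (@holomorphic_vec R 1 3 phi setT) => // p' _; apply: ord3P.
  + by under [X in cdifferentiable X]eq_fun do rewrite ptE;
      under [X in _ /\ X]eq_forall do under eq_fun do rewrite ptE; exact: cholomorphic_cst.
  + by under [X in cdifferentiable X]eq_fun do rewrite ptE;
      under [X in _ /\ X]eq_forall do under eq_fun do rewrite ptE; exact: cholomorphic_ccoord.
  + by under [X in cdifferentiable X]eq_fun do rewrite ptE;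
      under [X in _ /\ X]eq_forall do under eq_fun do rewrite ptE; exact: cholomorphic_cst.
- move=> w _ v v' vv'; apply: ccoordP => j; rewrite ord1.
  have dv k : ccoord ('d phi w k) 1 = ccoord k 0.
    rewrite -deriveE // ccoord_derive //.
    by under [X in cD _ X]eq_fun do rewrite ptE; rewrite cD_ccoord.
  by rewrite -dv vv' dv.
- apply: topological_embedding_local_inverse => [w _|w _].
    exact: smooth_continuous sphi I.
  exists g; first exact: smooth_continuous sg I.
  have : \forall p' \near phi w, [set: Cn R 3] p'.
    by apply: open_nbhs_nbhs; split=> //; exact: openT.
  by apply: filterS => p' _ w' _ <-; rewrite phiK.
- rewrite setIT; apply/seteqP; split=> p' /=; first by move=> [w _ <-]; exists (ccoord w 0).
  by move=> [t _ <-]; exists (cvec 1 [:: t]) => //; rewrite /phi ccoord_cvec.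
Qed.

Lemma pure_variety_axis : pure_variety 1 setT axis.
Proof.
split; last by move=> p ap; apply: subset_closure; split=> //; exact: axis_manifold.
split=> // p _.
exists setT, 2%N, (fun p => pt2 (ccoord p 0) (ccoord p 2)); split=> //.
- exact: openT.
- apply: holomorphic_vec => p' _; apply: ord2P;
  by under [X in cdifferentiable X]eq_fun do rewrite ptE;
     under [X in _ /\ X]eq_forall do under eq_fun do rewrite ptE; exact: cholomorphic_ccoord.
- rewrite setIT; apply/seteqP; split=> p' /=.
    by move=> /axisP[-> ->]; split=> //; apply: ccoordP; apply: ord2P; rewrite ptE ccoord0.
  move=> [_ e]; apply/axisP; split.
    by have := congr1 (fun w : Cn R 2 => ccoord w 0) e; rewrite ptE ccoord0.
  by have := congr1 (fun w : Cn R 2 => ccoord w 1) e; rewrite ptE ccoord0.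
Qed.

End Varieties.

(** * The singular locus *)

Section Immersions.
Variable R : realType.

Lemma continuous_linear_Cn n (G : normedModType R) (f : {linear Cn R n -> G}) :
  continuous f.
Proof.
have oT := @openT (Cn R n).
have sj j : Ck_on 0 setT (fun p : Cn R n => re_coord j p *: f (delta_mx 0 j, 0) +
    im_coord j p *: f (0, delta_mx 0 j)).
  have [sr si] := @csmooth_ccoord R n setT j.
  exact: (Ck_onD oT (Ck_onZl _ oT (sr 0%N)) (Ck_onZl _ oT (si 0%N))).
have fE : (f : _ -> _) = \sum_j (fun p : Cn R n => re_coord j p *: f (delta_mx 0 j, 0) +
    im_coord j p *: f (0, delta_mx 0 j)).
  apply/funext => p; rewrite [p in LHS]Cn_basis fct_sumE raddf_sum.
  by apply: eq_bigr => j _; rewrite raddfD /= !linearZ.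
suff : Ck_on 0 setT (f : _ -> _) by move=> cf p; exact: cf.
rewrite fE; elim/big_ind: _; [exact: (Ck_on_cst 0 setT (0 : G))| |by move=> j _; exact: sj].
by move=> g h sg sh; exact: Ck_onD.
Qed.

Lemma linear_left_inverse m n (f : {linear Cn R m -> Cn R n}) : injective f ->
  exists L : {linear Cn R n -> Cn R m}, cancel f L.
Proof.
move=> fi; pose F := linfun f.
have F0 : lker F == 0%VS.
  by apply/lker0P => x y; rewrite !lfunE; exact: fi.
exists (F^-1)%VF => x; have := lker0_lfunK F0 x.
by rewrite lfunE.
Qed.

Lemma derive_quotient (G : normedModType R) (c : R^o -> G) : differentiable c 0 ->
  (fun t : R => t^-1 *: (c t - c 0)) @ (0 : R)^' --> 'D_(1 : R^o) c 0.
Proof.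
move=> dc; have /derivableP[dcv _] : derivable c 0 (1 : R^o) by exact: diff_derivable.
rewrite (_ : (fun t : R => _) =
    (fun h : R => h^-1 *: ((c \o shift 0) (h *: (1 : R^o)) - c 0))); first exact: dcv.
by apply/funext => t; rewrite /= addr0 -[t *: _]/(t * 1) mulr1.
Qed.

(* With [L] a left inverse of the differential, [h = w - w0] is controlled by
   [L (phi w - phi w0)], so that [phi w - phi w0] is killed to first order by
   [id - 'd phi w0 \o L]. *)
Lemma immersed_velocity m n (W : set (Cn R m)) (phi : Cn R m -> Cn R n) w0
    (c : R^o -> Cn R n) :
  topological_embedding W phi -> W w0 -> differentiable phi w0 ->
  injective ('d phi w0) -> differentiable c 0 -> c 0 = phi w0 ->
  (\forall t \near (0 : R^o), (phi @` W) (c t)) ->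
  exists h, 'd phi w0 h = 'D_(1 : R^o) c 0.
Proof.
move=> [_ [g cg gK]] Ww0 dphi iphi dc c0 cW.
have [L LK] := linear_left_inverse iphi.
have cL : continuous L by exact: continuous_linear_Cn.
have [kL kL0 Lb] := linear_lipschitz cL.
set T := 'd phi w0 in iphi LK *.
have cT : continuous T by exact: continuous_linear_Cn.
have [kT kT0 Tb] := linear_lipschitz cT.
(* If [a] is in the range of [T], its preimage can only be [L a]; it is shown that |T (L a) - a| is
   at most every positive [eps]. *)
set a := 'D_(1 : R^o) c 0; exists (L a); apply/eqP; rewrite -subr_eq0 -normr_le0.
have cc : {for (0 : R^o), continuous c} by exact: differentiable_continuous.
(* Only the continuity of the inverse is available, so the lift of the curve converges but has no
   known derivative. *)
have cgc : (fun t => g (c t)) @ (0 : R^o) --> w0.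
  have cW0 : (phi @` W) (c 0) by rewrite c0; exists w0.
  have cg0 : g @ within (phi @` W) (nbhs (c 0)) --> g (c 0).
    by have /subspace_continuousP/(_ _ cW0) := cg.
  have -> : w0 = g (c 0) by rewrite c0 gK.
  apply: cvg_trans cg0 => A /= wA.
  have nc : \forall t \near (0 : R^o), (phi @` W) (c t) -> A (g (c t)).
    exact: (cc _ wA).
  have nA : \forall t \near (0 : R^o), A (g (c t)).
    by apply: filterS2 cW nc => t h1; apply.
  exact: nA.
have phig : \forall t \near (0 : R^o), phi (g (c t)) = c t.
  by apply: filterS cW => t [w Ww wc]; rewrite -wc gK.
have dlim := derive_quotient dc.
apply/ler_addgt0Pl => eps eps0; rewrite addr0.
pose A := `|a| + 1; have A0 : 0 < A by rewrite ltr_pwDr.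
(* With d = c t - c 0 and h = g (c t) - w0, the choice kL e <= 1/2 gives |L d - h| <= |h| / 2, so
   |h| is absorbed into |h| <= 2 kL A |t|. Then |d - T (L d)| <= (1 + kT kL) e |h| <= B e |t|, and B
   e <= eps / 2. *)
pose B := (1 + kT * kL) * (2 * kL * A); have B0 : 0 < B.
  apply: mulr_gt0; last by rewrite !mulr_gt0.
  by apply: ltr_pwDl => //; rewrite ltW // mulr_gt0.
pose e := Num.min (1 / (2 * kL)) (eps / (2 * B)).
have e0 : 0 < e by rewrite lt_min !divr_gt0 // mulr_gt0.
have ek : kL * e <= 1 / 2.
  have : e <= 1 / (2 * kL) by rewrite ge_min lexx.
  rewrite -(ler_pM2l kL0) => /le_trans; apply.
  by rewrite le_eqVlt; apply/orP; left; apply/eqP; field; rewrite gt_eqF.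
have eB : B * e <= eps / 2.
  have : e <= eps / (2 * B) by rewrite ge_min lexx orbT.
  rewrite -(ler_pM2l B0) => /le_trans; apply.
  by rewrite le_eqVlt; apply/orP; left; apply/eqP; field; rewrite gt_eqF.
have small : \forall x \near (0 : Cn R m), `|phi (x + w0) - phi w0 - T x| <= e * `|x|.
  have /eqaddoP := diff_locally dphi => /(_ e e0); apply: filterS => x.
  by rewrite !fctE /= opprD addrA.
have hto0 : (fun t => g (c t) - w0) @ (0 : R^o) --> (0 : Cn R m).
  by rewrite -[X in _ --> X](subrr w0); apply: cvgB cgc _; exact: cvg_cst.
have small_t : \forall t \near (0 : R^o),
    `|c t - c 0 - T (g (c t) - w0)| <= e * `|g (c t) - w0|.
  have nh : \forall t \near (0 : R^o),
      `|phi (g (c t) - w0 + w0) - phi w0 - T (g (c t) - w0)| <= e * `|g (c t) - w0|.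
    exact: (hto0 _ small).
  by apply: filterS2 phig nh => t pg; rewrite subrK pg c0.
pose G x := x - T (L x).
have cG : continuous G.
  by move=> x; apply: cvgB; [exact: cvg_id|apply: (continuous_comp (cL x)); exact: cT].
have Glim : (fun t : R => G (t^-1 *: (c t - c 0))) @ (0 : R)^' --> G a.
  by apply: (cvg_comp _ _ dlim); exact: cG.
have n1 : \forall t \near (0 : R)^', `|t^-1 *: (c t - c 0)| <= A.
  have /cvgrPdist_le/(_ 1 ltr01) := dlim; apply: filterS => t le1.
  rewrite -[X in `|X|](subrK a) (le_trans (ler_normD _ _)) // addrC lerD2l.
  by rewrite distrC.
have nG : \forall t \near (0 : R)^', `|G a - G (t^-1 *: (c t - c 0))| <= eps / 2.
  by have /cvgrPdist_le := Glim; apply; rewrite divr_gt0.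
have n3 : \forall t \near (0 : R)^',
    `|c t - c 0 - T (g (c t) - w0)| <= e * `|g (c t) - w0|.
  by apply: nbhs_dnbhs; exact: small_t.
have n4 : \forall t \near (0 : R)^', t != 0 by exact: nbhs_dnbhs_neq.
have [t [[t1 t2] [t3 t4]]] := filter_ex (filterI (filterI n1 nG) (filterI n3 n4)).
have tn0 : 0 < `|t| by rewrite normr_gt0.
pose d := c t - c 0; pose h := g (c t) - w0.
have dA : `|d| <= A * `|t|.
  move: t1; rewrite normrZ normfV -/d => /(ler_wpM2l (ltW tn0)).
  by rewrite mulrA mulfV ?mul1r ?gt_eqF // mulrC.
have Ldh : L d - h = L (d - T h).
  have -> : L (d - T h) = L d - L (T h) by exact: raddfB.
  by rewrite LK.
have Lh : `|L d - h| <= 1 / 2 * `|h|.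
  rewrite Ldh (le_trans (Lb _)) //.
  rewrite (le_trans (ler_wpM2l (ltW kL0) t3)) // mulrA ler_wpM2r //.
have hA : `|h| <= 2 * kL * A * `|t|.
  have h1 : `|h| <= `|L d| + 1 / 2 * `|h|.
    rewrite -[X in `|X| <= _](subrK (L d)) addrC (le_trans (ler_normD _ _)) // lerD2l.
    by rewrite distrC.
  have := Lb d; have := ler_wpM2l (ltW kL0) dA; rewrite !mulrA => *; lra.
have GdE : G d = (d - T h) - T (L d - h).
  have -> : T (L d - h) = T (L d) - T h by exact: raddfB.
  by rewrite /G opprB addrA subrK.
have he : e * `|h| <= e * (2 * kL * A * `|t|).
  by apply: ler_wpM2l => //; exact: ltW.
have Gd : `|G d| <= eps / 2 * `|t|.
  rewrite GdE (le_trans (ler_normB _ _)) //.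
  have TLh : `|T (L d - h)| <= kT * (kL * (e * `|h|)).
    apply: (le_trans (Tb _)); apply: ler_wpM2l; first exact: ltW.
    by rewrite Ldh; apply: (le_trans (Lb _)); apply: ler_wpM2l => //; exact: ltW.
  have : kT * (kL * (e * `|h|)) <= kT * (kL * (e * (2 * kL * A * `|t|))).
    by do 2!(apply: ler_wpM2l; first exact: ltW).
  have := ler_wpM2r (ltW tn0) eB; rewrite /B.
  have := t3; rewrite -/h -/d; clear -he TLh; lra.
have GZ : G (t^-1 *: d) = t^-1 *: G d.
  rewrite /G; have -> : L (t^-1 *: d) = t^-1 *: L d by exact: linearZ.
  have -> : T (t^-1 *: L d) = t^-1 *: T (L d) by exact: linearZ.
  exact: esym (scalerBr _ _ _).
have Gq : `|G (t^-1 *: d)| <= eps / 2.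
  by rewrite GZ normrZ normfV mulrC ler_pdivrMr.
have := ler_normD (G a - G (t^-1 *: d)) (G (t^-1 *: d)); rewrite subrK /G => GG.
rewrite distrC; move: t2 Gq; rewrite -/d /G => t2 Gq; lra.
Qed.

End Immersions.

(** * Velocities of curves in the variety and the crossing of the two sheets *)

Section SingularLocus.
Variable R : realType.
Implicit Types (q : Cn R 2) (p : Cn R 3).

Local Notation V := (@variety R `\` @boundary R).

Definition ccvg (f : R -> R[i]) (l : R[i]) :=
  (fun t => Re (f t)) @ (0 : R)^' --> Re l /\ (fun t => Im (f t)) @ (0 : R)^' --> Im l.

Lemma ccvgB f g a b : ccvg f a -> ccvg g b -> ccvg (fun t => f t - g t) (a - b).
Proof.
move=> [fr fi] [gr gi]; split; rewrite !ReImE.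
  by under eq_fun do rewrite !ReImE; exact: cvgB.
by under eq_fun do rewrite !ReImE; exact: cvgB.
Qed.

Lemma ccvgM f g a b : ccvg f a -> ccvg g b -> ccvg (fun t => f t * g t) (a * b).
Proof.
move=> [fr fi] [gr gi]; split; rewrite !ReImE.
  by under eq_fun do rewrite !ReImE; apply: cvgB; exact: cvgM.
by under eq_fun do rewrite !ReImE; apply: cvgD; exact: cvgM.
Qed.

Lemma ccvg_quotient (f : R^o -> R[i]) : cdifferentiable f 0 ->
  ccvg (fun t => (t^-1)%:C%C * (f t - f 0)) (cD (1 : R^o) f 0).
Proof.
move=> [dr di]; split.
  under eq_fun do rewrite !ReImE /= mul0r subr0.
  exact: (derive_quotient dr).
under eq_fun do rewrite !ReImE /= mul0r addr0.
exact: (derive_quotient di).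
Qed.

Lemma ccvg_self (f : R^o -> R[i]) : cdifferentiable f 0 -> ccvg f (f 0).
Proof.
by move=> [dr di]; split; apply: cvg_within_filter;
  [exact: differentiable_continuous dr|exact: differentiable_continuous di].
Qed.

Lemma ccvg_near0 f a : (\forall t \near (0 : R)^', f t = 0) -> ccvg f a -> a = 0.
Proof.
move=> f0 [fr fi]; apply: complex_ext; rewrite ?ReImE.
  apply: (norm_cvg_unique fr); apply: cvg_near_cst.
  by move: f0; apply: filterS => t ->.
apply: (norm_cvg_unique fi); apply: cvg_near_cst.
by move: f0; apply: filterS => t ->.
Qed.

(* [z^2 - z x] is the lowest order part of the equation of the range of
   [Fmap] along the line [x = z = 0]. *)
Lemma velocity_in_cone (x z : R^o -> R[i]) :
  cdifferentiable x 0 -> cdifferentiable z 0 -> x 0 = 0 -> z 0 = 0 ->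
  (\forall t \near (0 : R^o), z t ^+ 2 - z t * x t - x t ^+ 3 = 0) ->
  cD (1 : R^o) z 0 * cD (1 : R^o) z 0 - cD (1 : R^o) z 0 * cD (1 : R^o) x 0 = 0.
Proof.
move=> dx dz x0 z0 P0.
have X := ccvg_quotient dx; have Z := ccvg_quotient dz; have xs := ccvg_self dx.
set X' := cD _ x 0 in X *; set Z' := cD _ z 0 in Z *.
(* The limit of the equation divided by t^2: the cubic term is (x/t)^2 x, whose last factor tends to
   x 0 = 0. *)
suff : Z' * Z' - Z' * X' - X' * X' * x 0 = 0 by rewrite x0 mulr0 subr0.
apply: ccvg_near0 (ccvgB (ccvgB (ccvgM Z Z) (ccvgM Z X)) (ccvgM (ccvgM X X) xs)).
have P0' : \forall t \near (0 : R)^', z t ^+ 2 - z t * x t - x t ^+ 3 = 0.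
  by apply: nbhs_dnbhs; exact: P0.
apply: filterS P0' => t Pt; rewrite x0 z0 !subr0.
set i := (t^-1)%:C%C.
have -> : i * z t * (i * z t) - i * z t * (i * x t) - i * x t * (i * x t) * x t =
  i ^+ 2 * (z t ^+ 2 - z t * x t - x t ^+ 3) by ring.
by rewrite Pt mulr0.
Qed.

Lemma axis_variety (t : R[i]) : sqn t < 3 -> V (pt3 0 t 0).
Proof.
move=> t3; split.
  exists (pt2 0 t); first by rewrite ballBE /= sqnorm_pt2 sqn0; lra.
  by rewrite FmapE mul0r expr0n mul0r.
move=> [q Sq Fq]; move: Sq; rewrite sphereSE /= /sqnorm.
have qt : ccoord q 1 = t by rewrite -Fmap1 Fq ptE.
have /eqP := congr1 (fun p => ccoord p 0) Fq.
by rewrite ptE Fmap0_eq0 qt => /orP[] /eqP ->; rewrite ?sqn0 ?sqn1 => ?; lra.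
Qed.

Lemma variety_equation p : V p -> ccoord p 2 ^+ 2 - ccoord p 2 * ccoord p 0 - ccoord p 0 ^+ 3 = 0.
Proof. by move=> [[q _ <-] _]; rewrite Fmap0 Fmap2; ring. Qed.

Lemma near_in_variety (c : R^o -> Cn R 2) (D : set (Cn R 3)) :
  {for (0 : R^o), continuous c} -> sqnorm (c 0) < 4 -> open D -> D (Fmap (c 0)) ->
  ~ boundary (Fmap (c 0)) -> \forall t \near (0 : R^o), (V `&` D) (Fmap (c t)).
Proof.
move=> cc c4 oD Dc nM.
have cF : {for (0 : R^o), continuous (fun t => Fmap (c t))}.
  by apply: (continuous_comp cc); exact: continuous_Fmap.
have nD : \forall t \near (0 : R^o), D (Fmap (c t)).
  by apply: (cF D); exact: open_nbhs_nbhs.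
have nB : \forall t \near (0 : R^o), (~` @boundary R) (Fmap (c t)).
  by apply: (cF (~` @boundary R)); apply: open_nbhs_nbhs; split=> //; exact: open_not_boundary.
have n4 : \forall t \near (0 : R^o), sqnorm (c t) < 4.
  have cn : (fun t : R^o => sqnorm (c t)) @ (0 : R^o) --> sqnorm (c 0).
    by apply: (continuous_comp cc); exact: continuous_sqnorm.
  by apply: (cn [set r | r < 4]); apply: open_nbhs_nbhs; split=> //; exact: open_lt.
apply: filterS3 nD nB n4 => t Dt Bt t4; split=> //; split=> //.
by exists (c t) => //; rewrite ballBE /= ltW.
Qed.

(* The two sheets through [(0, t, 0)] have the velocities [(-1, 0, 0)] and
   [(1, 0, 1)], whose sum does not lie in the cone [z^2 = z x]. *)
Lemma not_manifold_axis d (t : R[i]) : sqn t < 3 ->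
  ~ complex_manifold_at d V (pt3 0 t 0).
Proof.
move=> t3 [D [W [phi [[oD Dp] [oW hphi] iphi ephi imphi]]]].
have Vp := axis_variety t3.
have [w0 Ww0 w0p] : (phi @` W) (pt3 0 t 0) by rewrite imphi.
have dphi w : W w -> differentiable phi w by move=> /hphi[].
(* For u0 = 0 and u0 = 1 the curve s -> F (u0 + s, t) stays in the variety for small s, and its
   velocity at 0 is the tangent vector of the corresponding sheet. *)
have curve (u0 : R[i]) : u0 * (u0 - 1) = 0 -> sqn u0 + sqn t < 4 ->
    exists h, 'd phi w0 h = dF u0 1 0.
  move=> u00 u4; pose c (s : R^o) : Cn R 2 := pt2 (u0 + s%:C%C) t.
  have oT := @openT R^o.
  have sid : csmooth setT (fun s : R^o => s%:C%C).
    apply: csmooth_real => //.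
    exact: (@smooth_on_linear _ _ _ setT (idfun : {linear R^o -> R}) (fun x => cvg_id)).
  have cs j : csmooth setT (fun s => ccoord (c s) j).
    by move: j; apply: ord2P; under [X in csmooth _ X]eq_fun do rewrite ptE; csmooth_tac.
  have c0 : c 0 = pt2 u0 t by rewrite /c [_ + _]addr0.
  have Fc0 : Fmap (c 0) = pt3 0 t 0.
    by rewrite c0 FmapE expr2 -mulrA u00 mulr0.
  have cd j : cdifferentiable (fun s => ccoord (c s) j) (0 : R^o).
    exact: csmooth_differentiable (cs j) I.
  have sF := smooth_Fmap_comp oT cs.
  have cc : {for (0 : R^o), continuous c}.
    exact: smooth_continuous (smooth_vec oT cs) I.
  have dc0 : cD (1 : R^o) (fun s => ccoord (c s) 0) 0 = 1.
    under [X in cD _ X]eq_fun do rewrite ptE.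
    rewrite (cDD _ (cdifferentiable_cst u0 (0 : R^o)) (csmooth_differentiable sid I)).
    by rewrite cD_cst add0r /cD /= derive_cst derive_id.
  have dc1 : cD (1 : R^o) (fun s => ccoord (c s) 1) 0 = 0.
    by under [X in cD _ X]eq_fun do rewrite ptE; rewrite cD_cst.
  have cW : \forall s \near (0 : R^o), (phi @` W) (Fmap (c s)).
    rewrite imphi; apply: near_in_variety => //; rewrite ?Fc0 //; last by case: Vp.
    by rewrite c0 sqnorm_pt2.
  have [h hE] := immersed_velocity ephi Ww0 (dphi _ Ww0) (iphi _ Ww0)
    (smooth_on_differentiable sF I) (etrans Fc0 (esym w0p)) cW.
  by exists h; rewrite hE derive_Fmap_comp // dc0 dc1 c0 ptE.
have [h0 h0E] : exists h, 'd phi w0 h = dF 0 1 0.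
  by apply: curve; [rewrite mul0r|rewrite sqn0; lra].
have [h1 h1E] : exists h, 'd phi w0 h = dF 1 1 0.
  by apply: curve; [rewrite subrr mulr0|rewrite sqn1; lra].
(* The range of the differential is a linear space, so it contains the difference (2, 0, 1) of the
   two velocities; there z^2 = 1 while z x = 2. *)
pose h := h1 - h0.
have hE : 'd phi w0 h = pt3 2 0 1.
  rewrite /h raddfB /= h0E h1E; apply: ccoordP; apply: ord3P;
    by rewrite ccoordD ccoordN /dF !ptE; ring.
(* The image under [phi] of this line is a curve in the variety with velocity (2, 0, 1), against
   [velocity_in_cone]. *)
pose l (s : R^o) := w0 + s *: h.
have did : differentiable (fun s : R^o => s : R) 0.
  exact: (@smooth_on_differentiable _ _ _ _ setT 0
    (@smooth_on_linear _ _ _ setT (idfun : {linear R^o -> R}) (fun x => cvg_id)) I).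
have dl : differentiable l 0.
  apply: differentiableD; first exact: differentiable_cst.
  exact: (@differentiableZl _ _ _ (fun s : R^o => s : R) h 0 did).
have l0 : l 0 = w0 by rewrite /l scale0r addr0.
have Dl : 'D_(1 : R^o) l 0 = h.
  rewrite deriveD; [|exact: derivable_cst|].
    rewrite derive_cst add0r deriveE; last first.
      exact: (@differentiableZl _ _ _ (fun s : R^o => s : R) h 0 did).
    rewrite (@diffZl _ _ _ (fun s : R^o => s : R) h 0 did) -deriveE // derive_id.
    by rewrite scale1r.
  apply: diff_derivable; exact: (@differentiableZl _ _ _ (fun s : R^o => s : R) h 0 did).
pose c (s : R^o) := phi (l s).
have dphil : differentiable phi (l 0) by rewrite l0; exact: dphi.
have dc : differentiable c 0 by exact: (@differentiable_comp _ _ _ _ l phi).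
have Dc : 'D_(1 : R^o) c 0 = pt3 2 0 1.
  rewrite deriveE // (@diff_comp _ _ _ _ l phi) //= -(deriveE _ dl) Dl.
  by rewrite l0.
have c0 : c 0 = pt3 0 t 0 by rewrite /c l0.
have Pc : \forall s \near (0 : R^o), ccoord (c s) 2 ^+ 2 - ccoord (c s) 2 * ccoord (c s) 0 -
    ccoord (c s) 0 ^+ 3 = 0.
  have nW : \forall s \near (0 : R^o), W (l s).
    have cl : {for (0 : R^o), continuous l} by exact: differentiable_continuous.
    by apply: (cl W); rewrite l0; exact: open_nbhs_nbhs.
  apply: filterS nW => s Ws; apply: variety_equation.
  have : (phi @` W) (c s) by exists (l s).
  by rewrite imphi => -[].
have := velocity_in_cone (differentiable_ccoord 0 dc) (differentiable_ccoord 2 dc) _ _ Pc.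
rewrite c0 !ptE => /(_ erefl erefl).
rewrite -!ccoord_derive // Dc !ptE mulr1 mul1r => /eqP.
by rewrite subr_eq0 => /eqP /(congr1 (@complex.Re R)); rewrite !ReImE => ?; lra.
Qed.

Lemma singular_locus_variety :
  singular_locus V = @axis R `&` [set p | setT p /\ sqn (ccoord p 1) < 3].
Proof.
apply/seteqP; split=> p.
  move=> [Vp sing]; have x0 : ccoord p 0 = 0.
    apply/eqP/negPn/negP => x0; apply: sing; exists 2%N.
    by apply: chart_regular => //; case: Vp.
  have [pE [t3|t34]] := variety_axis Vp x0.
    by split=> //; rewrite pE; exists (ccoord p 1).
  by case: sing; exists 2%N; rewrite pE; exact: chart_branch.
move=> [[t _ <-]] [_]; rewrite ptE => t3; split; first exact: axis_variety.
by move=> [d]; exact: not_manifold_axis.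
Qed.

Lemma curve_singularities_variety : curve_singularities V (@axis R).
Proof.
split; first exact: pure_variety_axis.
  exists (pt3 0 0 0); rewrite singular_locus_variety; split; first by exists 0.
  by split=> //; rewrite ptE sqn0.
exists [set p | setT p /\ sqn (ccoord p 1) < 3]; last exact: singular_locus_variety.
by apply: open_coord_lt; exact: openT.
Qed.

End SingularLocus.

Theorem mainTheorem1 (R : realType) :
  [/\ holomorphic_on setT (@Fmap R),
      forall c : R[i],
        smooth_embedding
          ([set p | ccoord p 1 = c] `\` [set cvec 2 [:: 0; c]; cvec 2 [:: 1; c]])
          (@Fmap R),
      forall t : R[i], Fmap (cvec 2 [:: 0; t]) = cvec 3 [:: 0; t; 0] /\
                       Fmap (cvec 2 [:: 1; t]) = cvec 3 [:: 0; t; 0] &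
  [/\ smooth_embedding (@sphereS R) (@Fmap R),
      CR_manifold 2 (@Fmap R @` @sphereS R) /\ strongly_pseudoconvex (@Fmap R @` @sphereS R),
      bounds 2 (@Fmap R @` @sphereS R) (@Fmap R @` @ballB R),
      curve_singularities ((@Fmap R @` @ballB R) `\` (@Fmap R @` @sphereS R))
        [set cvec 3 [:: 0; t; 0] | t in [set: R[i]]] &
      range (@Fmap R) =
        [set p | ccoord p 2 ^+ 2 - ccoord p 2 * ccoord p 0 - ccoord p 0 ^+ 3 = 0]]].
Proof.
split.
- exact: holomorphic_Fmap.
- exact: line_embedding.
- by move=> t; split; rewrite FmapE; congr pt3; rewrite ?expr2 ?mul0r ?subrr ?mulr0.
split.
- exact: sphere_embedding.
- by split; [exact: CR_manifold_boundary|exact: strongly_pseudoconvex_boundary].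
- exact: bounds_variety.
- exact: curve_singularities_variety.
- exact: range_Fmap.
Qed.
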